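(* There exists an Anosov diffeomorphism $F:\mathbb{R}^2\to\mathbb{R}^2$ of the plane which has no fixed point and which is not topologically conjugate to a translation; that is, there are no homeomorphism $h:\mathbb{R}^2\to\mathbb{R}^2$ and translation $T:\mathbb{R}^2\to\mathbb{R}^2$ such that $h\circ F\circ h^{-1}=T$.
   Context: Definition (Anosov diffeomorphism of the plane). A $C^1$ diffeomorphism $F:\mathbb{R}^2\to\mathbb{R}^2$ is called an Anosov diffeomorphism if there are a continuous Riemannian metric $m$ on $\mathbb{R}^2$ and two mutually transversal continuous (one-dimensional) foliations $\mathcal{F}^u$ and $\mathcal{F}^s$ of $\mathbb{R}^2$ by $C^1$ leaves with the following properties: (1) the metric $m$ is complete; (2) $F$ preserves both foliations, i.e. for $\sigma\in\{u,s\}$, $F$ maps each leaf of $\mathcal{F}^\sigma$ to a leaf of $\mathcal{F}^\sigma$; (3) there are constants $C>0$ and $\lambda>0$ such that $$\|DF^n(v)\|_m\ \ge\ C^{-1}e^{\lambda n}\|v\|_m\quad\text{for all } v\in T\mathcal{F}^u,\ n\in\mathbb{N},$$ and $$\|DF^n(v)\|_m\ \le\ C e^{-\lambda n}\|v\|_m\quad\text{for all } v\in T\mathcal{F}^s,\ n\in\mathbb{N}.$$ Here $T\mathcal{F}^\sigma$ denotes the set of all vectors tangent to the leaves of $\mathcal{F}^\sigma$, and $\|\cdot\|_m$ is the norm on tangent vectors given by $m$. Transversality of the foliations means that at every point $p\in\mathbb{R}^2$ the tangent lines $T_p\mathcal{F}^u$ and $T_p\mathcal{F}^s$ are distinct.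 A continuous Riemannian metric is one whose coefficients are continuous functions (no further smoothness is required); completeness of $m$ means that $\mathbb{R}^2$ is complete for the distance defined as the infimum of $m$-lengths of piecewise $C^1$ paths. The foliations are only required to be continuous (topological) foliations whose individual leaves are $C^1$ curves. A translation is a map $p\mapsto p+w$ of $\mathbb{R}^2$ for a fixed vector $w\in\mathbb{R}^2$. *)

(* Defs.v *)
(* Stdlib real numbers with Coquelicot; the plane is R * R with its product
   uniform structure. *)
From Stdlib Require Import Reals Relations.
From Coquelicot Require Import Coquelicot.
Open Scope R_scope.

Notation plane := (R * R)%type.

(** Maps of the plane *)

Definition C1 (F : plane -> plane) : Prop :=
  exists DF : plane -> plane -> plane,
    forall p, filterdiff F (locally p) (DF p) /\
              forall v, continuous (fun q => DF q v) p.

Definition mutual_inverse (F G : plane -> plane) : Prop :=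
  (forall p, G (F p) = p) /\ (forall p, F (G p) = p).

Definition C1_diffeomorphism (F : plane -> plane) : Prop :=
  exists G, mutual_inverse F G /\ C1 F /\ C1 G.

Definition homeomorphism_with_inverse (h k : plane -> plane) : Prop :=
  mutual_inverse h k /\
  (forall p, continuous h p) /\ (forall p, continuous k p).

Definition translation (w : plane) : plane -> plane := fun p => plus p w.

Definition conjugate_to_translation (F : plane -> plane) : Prop :=
  exists h k w, homeomorphism_with_inverse h k /\
    forall p, h (F (k p)) = translation w p.

(** Curves *)

(* Membership in the open interval ]a, b[, possibly unbounded. *)
Definition in_open_interval (a b : Rbar) (t : R) : Prop :=
  Rbar_lt a t /\ Rbar_lt t b.

(* c is C^1 on the open interval ]a, b[, with velocity c'. *)
Definition C1_curve (a b : Rbar) (c c' : R -> plane) : Prop :=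
  forall t, in_open_interval a b t -> is_derive c t (c' t) /\ continuous c' t.

(* There is a subdivision 0 = s_0 < ... < s_n = 1 such that on each closed
   piece c is the restriction of a C^1 curve, i.e. c is C^1 there with
   one-sided derivatives at the ends. Continuity on [0, 1] follows, since
   consecutive closed pieces share an end point. *)
Definition piecewise_C1 (c : R -> plane) : Prop :=
  exists (n : nat) (s : nat -> R),
    s 0%nat = 0 /\ s n = 1 /\
    forall i : nat, (i < n)%nat ->
      s i < s (S i) /\
      exists e e' : R -> plane, C1_curve m_infty p_infty e e' /\
        forall t, s i <= t <= s (S i) -> c t = e t.

(** Continuous Riemannian metrics *)

Record riemannian_metric := {
  g11 : plane -> R;
  g12 : plane -> R;
  g22 : plane -> R;
  g11_continuous : forall p, continuous g11 p;
  g12_continuous : forall p, continuous g12 p;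
  g22_continuous : forall p, continuous g22 p;
  metric_positive : forall p v : plane, v <> (0, 0) ->
    0 < g11 p * fst v ^ 2 + 2 * g12 p * fst v * snd v + g22 p * snd v ^ 2
}.

(* Norm of the vector v tangent to the plane at p. *)
Definition mnorm (m : riemannian_metric) (p v : plane) : R :=
  sqrt (g11 m p * fst v ^ 2 + 2 * g12 m p * fst v * snd v
        + g22 m p * snd v ^ 2).

(* Only used for piecewise C^1 paths: the arbitrary value taken by [Derive] at
   the finitely many subdivision points does not affect the integral. *)
Definition path_length (m : riemannian_metric) (c : R -> plane) : R :=
  RInt (fun t => mnorm m (c t) (Derive (fun u => fst (c u)) t,
                                Derive (fun u => snd (c u)) t)) 0 1.

(* The set of lengths is nonempty and bounded below by 0, so its infimum is
   finite and the projection [real] loses nothing. *)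
Definition mdist (m : riemannian_metric) (p q : plane) : R :=
  real (Glb_Rbar (fun l => exists c : R -> plane,
    piecewise_C1 c /\ c 0 = p /\ c 1 = q /\ l = path_length m c)).

Definition complete_metric (m : riemannian_metric) : Prop :=
  forall x : nat -> plane,
    (forall eps : R, 0 < eps -> exists N : nat, forall i j : nat,
       (N <= i)%nat -> (N <= j)%nat -> mdist m (x i) (x j) < eps) ->
    exists p, is_lim_seq (fun n => mdist m (x n) p) 0.

(** Continuous one-dimensional foliations with C^1 leaves *)

(* A homeomorphism from an open set onto an open rectangle
   ]a, b[ x ]c, d[ (possibly unbounded), given with its inverse. *)
Record foliated_chart := {
  dom : plane -> Prop;
  to_box : plane -> plane;
  of_box : plane -> plane;
  box_a : Rbar; box_b : Rbar; box_c : Rbar; box_d : Rbar;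
  in_box := fun z : plane => in_open_interval box_a box_b (fst z) /\
                             in_open_interval box_c box_d (snd z);
  dom_open : open dom;
  to_box_in : forall p, dom p -> in_box (to_box p);
  of_box_in : forall z, in_box z -> dom (of_box z);
  to_boxK : forall p, dom p -> of_box (to_box p) = p;
  of_boxK : forall z, in_box z -> to_box (of_box z) = z;
  to_box_continuous : forall p, dom p -> continuous to_box p;
  of_box_continuous : forall z, in_box z -> continuous of_box z
}.

(* The plaques of a chart are the preimages of the horizontal segments
   ]a, b[ x {y}; this is the plaque through p, when p is in the domain. *)
Definition plaque (k : foliated_chart) (p q : plane) : Prop :=
  dom k p /\ dom k q /\ snd (to_box k p) = snd (to_box k q).

(* A foliation is given by a foliated atlas.
   - [charts_compatible]: near each point, two charts have the same plaques,
     i.e. the change of charts is locally of the form (x, y) |-> (f x y, g y).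
   - [plaques_C1]: each plaque is the image of an injective C^1 immersion of an
     open interval. A plaque is homeomorphic to an interval, so this
     immersion is a homeomorphism onto the plaque. No regularity of the
     tangent lines in the direction transverse to the leaves is asked for. *)
Record foliation := {
  atlas : foliated_chart -> Prop;
  atlas_cover : forall p, exists k, atlas k /\ dom k p;
  charts_compatible : forall k1 k2 p, atlas k1 -> atlas k2 ->
    dom k1 p -> dom k2 p ->
    exists W : plane -> Prop, open W /\ W p /\
      (forall q, W q -> dom k1 q /\ dom k2 q) /\
      (forall q r, W q -> W r -> (plaque k1 q r <-> plaque k2 q r));
  plaques_C1 : forall k p, atlas k -> dom k p ->
    exists (a b : Rbar) (c c' : R -> plane),
      C1_curve a b c c' /\
      (forall t, in_open_interval a b t -> c' t <> (0, 0)) /\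
      (forall t u, in_open_interval a b t -> in_open_interval a b u ->
         c t = c u -> t = u) /\
      (forall q, plaque k p q <-> exists t, in_open_interval a b t /\ c t = q)
}.

(* The leaf through p: all points joined to p by a finite chain of plaques. *)
Definition leaf (Fol : foliation) : plane -> plane -> Prop :=
  clos_refl_trans plane (fun p q => exists k, atlas Fol k /\ plaque k p q).

(* v is tangent at p to the leaf through p: it is the velocity at p of a C^1
   curve in the leaf. The curve is required to lie in one plaque, so that it
   is continuous for the intrinsic topology of the leaf. *)
Definition tangent (Fol : foliation) (p v : plane) : Prop :=
  exists (k : foliated_chart) (eps : R) (c c' : R -> plane),
    atlas Fol k /\ 0 < eps /\ C1_curve (- eps) eps c c' /\
    c 0 = p /\ c' 0 = v /\
    forall t, - eps < t < eps -> plaque k p (c t).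

Definition transversal (Fol1 Fol2 : foliation) : Prop :=
  forall p, ~ (forall v, tangent Fol1 p v <-> tangent Fol2 p v).

Definition preserves (F : plane -> plane) (Fol : foliation) : Prop :=
  forall p, exists q, forall r,
    leaf Fol q r <-> exists r', leaf Fol p r' /\ F r' = r.

(** Anosov diffeomorphisms *)

(* [D] below is the differential at p of the n-th iterate of F, which exists
   and is unique when F is C^1. *)
Definition expands (F : plane -> plane) (m : riemannian_metric)
    (Fol : foliation) (C lambda : R) : Prop :=
  forall (n : nat) (p v : plane) (D : plane -> plane),
    tangent Fol p v -> filterdiff (Nat.iter n F) (locally p) D ->
    mnorm m (Nat.iter n F p) (D v) >= / C * exp (lambda * INR n) * mnorm m p v.

Definition contracts (F : plane -> plane) (m : riemannian_metric)
    (Fol : foliation) (C lambda : R) : Prop :=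
  forall (n : nat) (p v : plane) (D : plane -> plane),
    tangent Fol p v -> filterdiff (Nat.iter n F) (locally p) D ->
    mnorm m (Nat.iter n F p) (D v) <= C * exp (- lambda * INR n) * mnorm m p v.

Definition Anosov (F : plane -> plane) : Prop :=
  C1_diffeomorphism F /\
  exists (m : riemannian_metric) (Fu Fs : foliation),
    transversal Fu Fs /\
    complete_metric m /\
    preserves F Fu /\ preserves F Fs /\
    exists C lambda : R, 0 < C /\ 0 < lambda /\
      expands F m Fu C lambda /\ contracts F m Fs C lambda.

(* Main.v *)
Require Import Defs.
From Stdlib Require Import Reals Lra Lia ZArith Relations.
From Coquelicot Require Import Coquelicot.
Open Scope R_scope.

(** The diffeomorphism is the glide reflection F (x, y) = (x + PI, - y), the map
    [glide 1]. It moves every point, and it reverses the orientation, so that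
    no conjugacy can turn it into a translation. Here is an elementary form of
    the last point. If h conjugates F to the translation by w, then the image L
    of the axis y = 0 is invariant by w and lies at bounded distance from the
    direction of w, because F acts cocompactly on the axis. Far from L, the
    plane contains a segment from a point q to q + w that avoids L. But F
    exchanges the two sides of the axis, so q and q + w come from opposite
    sides, and the segment has to cross L ([glide_not_conjugate]).

    The work is to make F an Anosov diffeomorphism. The foliations and the metric
    are invariant by the vertical translations.
    - The stable leaves are the lines x = n PI and the vertical translates of
      the graph of 1 / sin x. They are tangent to the field
      (sin^2 x, - cos x). Between two consecutive lines they are U-shaped, with
      the opening up or down alternately, and the leaf space is not Hausdorff.
    - The unstable leaves are the lines x = PI / 2 + n PI and, with
      s = x - PI / 2, the vertical translates of the graph of cos s / |sin s|.
      They are tangent to the field (cos x |cos x|, 1).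
    - A vector v is unstable if a (v) = v_1 - cos x |cos x| v_2 vanishes and
      stable if b (v) = cos x v_1 + sin^2 x v_2 vanishes. The metric is
      e^(-2x) a^2 + e^(2x) b^2. Since F preserves a and b up to sign, it
      multiplies the norms of unstable vectors by e^PI and those of stable
      vectors by e^(-PI) ([glide_expands], [glide_contracts]).

    The metric is complete for the following reason. As x tends to +oo only
    the stable direction is cheap, but a stable leaf does not cross the lines
    x = n PI. The first component sin^2 x of the stable field vanishes there to
    the second order. So, over a width e^(-n PI) around the line x = n PI, the
    stable direction contributes no more to the crossing than the expensive
    unstable direction, and the crossing costs a length bounded below. As x
    tends to -oo, the same holds for the unstable direction and the lines
    x = PI / 2 + n PI. The function [staircase] of x makes this precise: far
    from x = 0 it grows by about PI near each of these lines and is nearly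
    constant in between, its differential is bounded by twice the norm
    ([staircase_speed]), and it differs from x by at most PI / 2. So a
    path of bounded length stays in a vertical strip, and there the metric is
    comparable to the Euclidean one ([anosov_metric_complete]). *)

(** * Continuity of functions given by formulas *)

Lemma continuous_pair {U V W : UniformSpace} (f : U -> V) (g : U -> W) (x : U) :
  continuous f x -> continuous g x -> continuous (fun u => (f u, g u)) x.
Proof.
intros Hf Hg P [e He].
assert (L : locally x (fun u => ball (f x) e (f u) /\ ball (g x) e (g u))).
{ apply filter_and.
  - exact (Hf _ (locally_ball _ e)).
  - exact (Hg _ (locally_ball _ e)). }
unfold filtermap. revert L; apply filter_imp; intros u [H1 H2].
apply He; split; assumption.
Qed.

Lemma continuous_real_comp {U : UniformSpace} (f : R -> R) (g : U -> R) (x : U) :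
  continuity_pt f (g x) -> continuous g x -> continuous (fun u => f (g u)) x.
Proof.
intros Hf Hg. apply (continuous_comp g f); [exact Hg|].
now apply continuity_pt_filterlim.
Qed.

Lemma continuous_inv_fct {U : UniformSpace} (g : U -> R) (x : U) :
  g x <> 0 -> continuous g x -> continuous (fun u => / g u) x.
Proof.
intros H Hg. apply (continuous_real_comp Rinv); [|exact Hg].
apply continuity_pt_filterlim, continuous_Rinv, H.
Qed.

Lemma continuous_sqrt_fct {U : UniformSpace} (g : U -> R) (x : U) :
  continuous g x -> continuous (fun u => sqrt (g u)) x.
Proof.
intros Hg. apply (continuous_comp g sqrt); [exact Hg|]. apply continuous_sqrt.
Qed.

Lemma continuous_abs_fct {U : UniformSpace} (g : U -> R) (x : U) :
  continuous g x -> continuous (fun u => Rabs (g u)) x.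
Proof.
intros Hg. apply (continuous_comp g Rabs); [exact Hg|]. apply continuous_Rabs.
Qed.

Lemma continuous_plus_fct {U : UniformSpace} (f g : U -> R) (x : U) :
  continuous f x -> continuous g x -> continuous (fun u => f u + g u) x.
Proof. apply @continuous_plus. Qed.

Lemma continuous_minus_fct {U : UniformSpace} (f g : U -> R) (x : U) :
  continuous f x -> continuous g x -> continuous (fun u => f u - g u) x.
Proof. apply @continuous_minus. Qed.

Lemma continuous_mult_fct {U : UniformSpace} (f g : U -> R) (x : U) :
  continuous f x -> continuous g x -> continuous (fun u => f u * g u) x.
Proof. apply @continuous_mult. Qed.

Lemma continuous_opp_fct {U : UniformSpace} (g : U -> R) (x : U) :
  continuous g x -> continuous (fun u => - g u) x.
Proof. apply @continuous_opp. Qed.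

Lemma continuous_pow_fct {U : UniformSpace} (g : U -> R) (n : nat) (x : U) :
  continuous g x -> continuous (fun u => g u ^ n) x.
Proof.
intros Hg; induction n as [|n IH]; simpl.
- apply continuous_const.
- now apply continuous_mult_fct.
Qed.

Lemma continuous_div_fct {U : UniformSpace} (f g : U -> R) (x : U) :
  g x <> 0 -> continuous f x -> continuous g x ->
  continuous (fun u => f u / g u) x.
Proof.
intros H Hf Hg. apply continuous_mult_fct; [exact Hf|]. now apply continuous_inv_fct.
Qed.

Lemma continuous_fst_fct {U V W : UniformSpace} (f : U -> V * W) (x : U) :
  continuous f x -> continuous (fun u => fst (f u)) x.
Proof.
intros Hf. apply (continuous_comp f fst); [exact Hf|].
destruct (f x). apply continuous_fst.
Qed.

Lemma continuous_snd_fct {U V W : UniformSpace} (f : U -> V * W) (x : U) :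
  continuous f x -> continuous (fun u => snd (f u)) x.
Proof.
intros Hf. apply (continuous_comp f snd); [exact Hf|].
destruct (f x). apply continuous_snd.
Qed.

Lemma continuous_sin_fct {U : UniformSpace} (g : U -> R) (x : U) :
  continuous g x -> continuous (fun u => sin (g u)) x.
Proof. apply continuous_real_comp, continuity_sin. Qed.

Lemma continuous_cos_fct {U : UniformSpace} (g : U -> R) (x : U) :
  continuous g x -> continuous (fun u => cos (g u)) x.
Proof. apply continuous_real_comp, continuity_cos. Qed.

Lemma continuous_exp_fct {U : UniformSpace} (g : U -> R) (x : U) :
  continuous g x -> continuous (fun u => exp (g u)) x.
Proof.
apply continuous_real_comp. apply derivable_continuous_pt, derivable_pt_exp.
Qed.

Lemma continuous_atan_fct {U : UniformSpace} (g : U -> R) (x : U) :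
  continuous g x -> continuous (fun u => atan (g u)) x.
Proof.
apply continuous_real_comp. apply derivable_continuous_pt, derivable_pt_atan.
Qed.

Ltac continuity_of_formula :=
  lazymatch goal with
  | |- continuous (fun _ => ?c) _ => apply continuous_const
  | |- continuous (fun u => u) _ => apply continuous_id
  | |- continuous (fun u => (@?f u) + (@?g u)) _ =>
      apply (continuous_plus_fct f g); continuity_of_formula
  | |- continuous (fun u => (@?f u) - (@?g u)) _ =>
      apply (continuous_minus_fct f g); continuity_of_formula
  | |- continuous (fun u => (@?f u) * (@?g u)) _ =>
      apply (continuous_mult_fct f g); continuity_of_formula
  | |- continuous (fun u => (@?f u) / (@?g u)) _ =>
      apply (continuous_div_fct f g); [|continuity_of_formula|continuity_of_formula]
  | |- continuous (fun u => - (@?g u)) _ =>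
      apply (continuous_opp_fct g); continuity_of_formula
  | |- continuous (fun u => (@?g u) ^ ?n) _ =>
      apply (continuous_pow_fct g n); continuity_of_formula
  | |- continuous (fun u => sqrt (@?g u)) _ =>
      apply (continuous_sqrt_fct g); continuity_of_formula
  | |- continuous (fun u => Rabs (@?g u)) _ =>
      apply (continuous_abs_fct g); continuity_of_formula
  | |- continuous (fun u => sin (@?g u)) _ =>
      apply (continuous_sin_fct g); continuity_of_formula
  | |- continuous (fun u => cos (@?g u)) _ =>
      apply (continuous_cos_fct g); continuity_of_formula
  | |- continuous (fun u => exp (@?g u)) _ =>
      apply (continuous_exp_fct g); continuity_of_formula
  | |- continuous (fun u => atan (@?g u)) _ =>
      apply (continuous_atan_fct g); continuity_of_formula
  | |- continuous (fun u => (@?f u, @?g u)) _ =>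
      apply (continuous_pair f g); continuity_of_formula
  | |- continuous (fun u => fst (@?f u)) _ =>
      apply (continuous_fst_fct f); continuity_of_formula
  | |- continuous (fun u => snd (@?f u)) _ =>
      apply (continuous_snd_fct f); continuity_of_formula
  | |- continuous fst _ => apply (continuous_fst_fct (fun u => u)), continuous_id
  | |- continuous snd _ => apply (continuous_snd_fct (fun u => u)), continuous_id
  | |- _ => try assumption
  end.

(** * Half-angles *)

Lemma sin_IZR_PI (n : Z) : sin (IZR n * PI) = 0.
Proof. apply sin_eq_0_1; now exists n. Qed.

Lemma cos_sqr_IZR_PI (n : Z) : cos (IZR n * PI) * cos (IZR n * PI) = 1.
Proof.
pose proof (sin2_cos2 (IZR n * PI)) as K. unfold Rsqr in K.
rewrite sin_IZR_PI in K. lra.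
Qed.

Lemma cos_IZR_PI_cases (n : Z) : cos (IZR n * PI) = 1 \/ cos (IZR n * PI) = - 1.
Proof.
pose proof (cos_sqr_IZR_PI n) as H.
assert (K : (cos (IZR n * PI) - 1) * (cos (IZR n * PI) + 1) = 0) by lra.
apply Rmult_integral in K. destruct K; [left|right]; lra.
Qed.

Lemma Rabs_cos_IZR_PI (n : Z) : Rabs (cos (IZR n * PI)) = 1.
Proof.
destruct (cos_IZR_PI_cases n) as [->| ->].
- apply Rabs_R1.
- rewrite Rabs_left; lra.
Qed.

Lemma sin_minus_IZR_PI (n : Z) (s : R) :
  sin (s - IZR n * PI) = cos (IZR n * PI) * sin s.
Proof. rewrite sin_minus, sin_IZR_PI. ring. Qed.

Lemma cos_minus_IZR_PI (n : Z) (s : R) :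
  cos (s - IZR n * PI) = cos (IZR n * PI) * cos s.
Proof. rewrite cos_minus, sin_IZR_PI. ring. Qed.

(** The tangent of half the argument of the vector (X, Y): a formula for the
    argument that is continuous off the half-line Y = 0, X <= 0. *)
Definition half (X Y : R) : R := Y / (X + sqrt (X ^ 2 + Y ^ 2)).

Lemma half_denominator_pos (X Y : R) :
  Y <> 0 \/ 0 < X -> 0 < X + sqrt (X ^ 2 + Y ^ 2).
Proof.
intros H.
assert (HX : Rabs X <= sqrt (X ^ 2 + Y ^ 2)).
{ rewrite <- sqrt_Rsqr_abs. apply sqrt_le_1_alt. unfold Rsqr. nra. }
destruct H as [H|H].
- assert (HX' : Rabs X < sqrt (X ^ 2 + Y ^ 2)).
  { rewrite <- sqrt_Rsqr_abs. apply sqrt_lt_1_alt. unfold Rsqr. nra. }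
  revert HX'. unfold Rabs. destruct (Rcase_abs X); lra.
- pose proof (sqrt_pos (X ^ 2 + Y ^ 2)). lra.
Qed.

Lemma half_zero (X : R) : half X 0 = 0.
Proof. unfold half, Rdiv. ring. Qed.

(** The formula of the tangent of the double angle; with the sign of Y it
    determines the half-angle ([half_unique]). *)
Lemma half_equation (X Y : R) :
  Y <> 0 \/ 0 < X -> 2 * half X Y * X = Y * (1 - half X Y ^ 2).
Proof.
intros H. pose proof (half_denominator_pos X Y H) as Hpos.
unfold half. set (r := sqrt (X ^ 2 + Y ^ 2)) in *.
assert (Hr : r * r = X ^ 2 + Y ^ 2) by (apply sqrt_sqrt; nra).
apply (Rmult_eq_reg_r ((X + r) ^ 2)); [|apply pow_nonzero; lra].
replace (2 * (Y / (X + r)) * X * (X + r) ^ 2) with (2 * Y * X * (X + r))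
  by (field; lra).
replace (Y * (1 - (Y / (X + r)) ^ 2) * (X + r) ^ 2)
  with (Y * ((X + r) ^ 2 - Y ^ 2)) by (field; lra).
replace (Y ^ 2) with (r * r - X ^ 2) by lra. ring.
Qed.

Lemma half_sign (X Y : R) : Y <> 0 -> 0 < Y * half X Y.
Proof.
intros H. pose proof (half_denominator_pos X Y (or_introl H)) as Hpos.
unfold half. replace (Y * (Y / (X + sqrt (X ^ 2 + Y ^ 2))))
  with (Y ^ 2 * / (X + sqrt (X ^ 2 + Y ^ 2))) by (field; lra).
apply Rmult_lt_0_compat; [nra|]. now apply Rinv_0_lt_compat.
Qed.

Lemma half_unique (X Y u : R) :
  0 < Y * u -> 2 * u * X = Y * (1 - u ^ 2) -> half X Y = u.
Proof.
intros Hs He.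
assert (HY : Y <> 0) by (intro K; rewrite K in Hs; lra).
pose proof (half_equation X Y (or_introl HY)) as He'.
pose proof (half_sign X Y HY) as Hs'. set (w := half X Y) in *.
assert (Hp : 0 < u * w).
{ assert (0 < (Y * u) * (Y * w)) by nra. nra. }
assert (E : Y * ((w - u) * (1 + u * w)) = 0).
{ replace (Y * ((w - u) * (1 + u * w)))
    with (w * (Y * (1 - u ^ 2)) - u * (Y * (1 - w ^ 2))) by ring.
  rewrite <- He, <- He'. ring. }
apply Rmult_integral in E. destruct E as [E|E]; [contradiction|].
apply Rmult_integral in E. destruct E as [E|E]; lra.
Qed.

Lemma continuous_half {U : UniformSpace} (f g : U -> R) (x : U) :
  g x <> 0 \/ 0 < f x -> continuous f x -> continuous g x ->
  continuous (fun u => half (f u) (g u)) x.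
Proof.
intros H Hf Hg. unfold half. pose proof (half_denominator_pos _ _ H) as Hp.
continuity_of_formula. lra.
Qed.

Lemma cos_2atan (u : R) : cos (2 * atan u) = (1 - u ^ 2) / (1 + u ^ 2).
Proof.
rewrite cos_2a_cos, cos_atan.
assert (H : 0 < 1 + u ^ 2) by nra.
assert (Hs : sqrt (1 + u²) * sqrt (1 + u²) = 1 + u ^ 2)
  by (rewrite sqrt_sqrt; unfold Rsqr; nra).
assert (Hp : 0 < sqrt (1 + u²)) by (apply sqrt_lt_R0; unfold Rsqr; nra).
replace (2 * (1 / sqrt (1 + u²)) * (1 / sqrt (1 + u²)))
  with (2 / (sqrt (1 + u²) * sqrt (1 + u²))) by (field; lra).
rewrite Hs. field. lra.
Qed.

Lemma sin_2atan (u : R) : sin (2 * atan u) = 2 * u / (1 + u ^ 2).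
Proof.
rewrite sin_2a, cos_atan, sin_atan.
assert (H : 0 < 1 + u ^ 2) by nra.
assert (Hs : sqrt (1 + u²) * sqrt (1 + u²) = 1 + u ^ 2)
  by (rewrite sqrt_sqrt; unfold Rsqr; nra).
assert (Hp : 0 < sqrt (1 + u²)) by (apply sqrt_lt_R0; unfold Rsqr; nra).
replace (2 * (u / sqrt (1 + u²)) * (1 / sqrt (1 + u²)))
  with (2 * u / (sqrt (1 + u²) * sqrt (1 + u²))) by (field; lra).
now rewrite Hs.
Qed.

Definition half_tan (s : R) : R := half (cos s) (sin s).

Lemma half_tan_2atan (u : R) : half_tan (2 * atan u) = u.
Proof.
unfold half_tan. rewrite cos_2atan, sin_2atan.
assert (H : 0 < 1 + u ^ 2) by nra.
destruct (Req_dec u 0) as [E|E].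
- subst u. replace (2 * 0 / (1 + 0 ^ 2)) with 0 by field. apply half_zero.
- apply half_unique; [|field; lra].
  replace (2 * u / (1 + u ^ 2) * u) with (2 * (u ^ 2 / (1 + u ^ 2)))
    by (field; lra).
  assert (0 < u ^ 2 / (1 + u ^ 2)) by (apply Rdiv_lt_0_compat; nra). lra.
Qed.

Lemma atan_2half_tan (s : R) : - PI < s < PI -> 2 * atan (half_tan s) = s.
Proof.
intros H. assert (E : s = 2 * atan (tan (s / 2))).
{ rewrite atan_tan; lra. }
rewrite E at 1. rewrite half_tan_2atan. lra.
Qed.

Lemma angle_2atan_bounds (u : R) : - PI < 2 * atan u < PI.
Proof. pose proof (atan_bound u). lra. Qed.

Lemma half_tan_domain (s : R) : - PI < s < PI -> sin s <> 0 \/ 0 < cos s.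
Proof.
intros H. rewrite <- (atan_2half_tan s H), cos_2atan, sin_2atan.
set (u := half_tan s). destruct (Req_dec u 0) as [E|E].
- right. rewrite E. lra.
- left. assert (0 < 1 + u ^ 2) by nra. unfold Rdiv.
  apply Rmult_integral_contrapositive; split; [lra|].
  apply Rinv_neq_0_compat. lra.
Qed.

Lemma sign_sin_half_tan (s : R) :
  - PI < s < PI -> exists k, 0 < k /\ sin s = k * half_tan s.
Proof.
intros H. pose proof (sin_2atan (half_tan s)) as E.
rewrite (atan_2half_tan s H) in E. rewrite E.
set (u := half_tan s). exists (2 / (1 + u ^ 2)). assert (0 < 1 + u ^ 2) by nra.
split; [|field; lra]. apply Rdiv_lt_0_compat; lra.
Qed.

(** * Charts of foliations by vertical lines and translated graphs *)

(** A profile describes the leaves, up to vertical translation: the vertical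
    lines s = n PI and the graphs of c + height between two lines. The charts
    straighten a neighbourhood of the line s = 0, with the coordinate
    u = tan (s / 2). By [height_half_tan],
    height = bend u + (1 - u^2) / (2 side u), where side u is either u or |u|.
    The sign of side u tells at which end, up or down, the leaves on the side
    of u are asymptotic to the line s = 0; bend u is continuous at the line, and
    is chosen so that bend u - y is a parameter along each leaf.
    [height_shift] makes the foliation invariant under glide reflections. The
    slope of the leaves is given as a fraction, because the denominator vanishes
    on the vertical leaves. *)
Record strip_profile := {
  side : R -> R;
  bend : R -> R;
  height : R -> R;
  slope_num : R -> R;
  slope_den : R -> R;
  side_continuous : forall u, continuous side u;
  side_0 : side 0 = 0;
  side_same_sign : forall u w, 0 < u * w -> side u * w = side w * u;
  side_nonzero : forall u, u <> 0 -> side u <> 0;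
  bend_continuous : forall u, continuous bend u;
  height_half_tan : forall u, u <> 0 ->
    (1 - u ^ 2) + 2 * bend u * side u = 2 * side u * height (2 * atan u);
  height_shift : forall (n : Z) s,
    height (s - IZR n * PI) = cos (IZR n * PI) * height s;
  height_derive : forall s, sin s <> 0 ->
    is_derive height s (slope_num s / slope_den s);
  slope_num_continuous : forall s, continuous slope_num s;
  slope_den_continuous : forall s, continuous slope_den s;
  slope_den_zero : forall s, slope_den s = 0 <-> sin s = 0
}.

(** For u = tan (s / 2), this is tan (s' / 2) where
    cot s' = cot s + t side u / u and s' has the sign of s. The factor
    side u / u is constant, 1 or -1, on each side of 0, so this is on each side
    a flow with time t, and its inverse is given by - t. The two flows extend
    continuously to the central line, which they fix. *)
Definition twist (P : strip_profile) (t u : R) : R :=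
  half (1 - u ^ 2 + 2 * t * side P u) (2 * u).

Lemma twist_domain (P : strip_profile) (t u : R) :
  2 * u <> 0 \/ 0 < 1 - u ^ 2 + 2 * t * side P u.
Proof.
destruct (Req_dec u 0) as [E|E]; [right|left; lra].
rewrite E, side_0. lra.
Qed.

Lemma twist_0 (P : strip_profile) (t : R) : twist P t 0 = 0.
Proof. unfold twist. replace (2 * 0) with 0 by ring. apply half_zero. Qed.

Lemma twist_sign (P : strip_profile) (t u : R) : u <> 0 -> 0 < u * twist P t u.
Proof.
intros H. pose proof (half_sign (1 - u ^ 2 + 2 * t * side P u) (2 * u)) as K.
unfold twist. assert (2 * u <> 0) by lra. specialize (K H0). nra.
Qed.

Lemma twist_equation (P : strip_profile) (t u : R) :
  twist P t u * (1 - u ^ 2 + 2 * t * side P u) = u * (1 - twist P t u ^ 2).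
Proof.
pose proof (half_equation _ _ (twist_domain P t u)) as K.
fold (twist P t u) in K. lra.
Qed.

Lemma twist_opp (P : strip_profile) (t u : R) : twist P (- t) (twist P t u) = u.
Proof.
destruct (Req_dec u 0) as [E|E].
- subst u. now rewrite !twist_0.
- pose proof (twist_sign P t u E) as S. pose proof (twist_equation P t u) as Q.
  set (w := twist P t u) in *.
  apply half_unique; [nra|].
  pose proof (side_same_sign P u w S) as K.
  replace (2 * u * (1 - w ^ 2 + 2 * - t * side P w))
    with (2 * (u * (1 - w ^ 2) - 2 * t * (side P w * u))) by ring.
  rewrite <- Q, <- K. ring.
Qed.

Lemma continuous_twist (P : strip_profile) {U : UniformSpace} (f g : U -> R) x :
  continuous f x -> continuous g x ->
  continuous (fun a => twist P (f a) (g a)) x.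
Proof.
intros Hf Hg. unfold twist. apply continuous_half; [apply twist_domain| |];
  continuity_of_formula.
apply (continuous_comp g (side P)); [exact Hg|]. apply side_continuous.
Qed.

(** The coordinates (s, y) in which strip n looks like strip 0: the height is
    reversed in every other strip. *)
Definition strip_coords (x0 : R) (n : Z) (p : plane) : plane :=
  (fst p - x0 - IZR n * PI, cos (IZR n * PI) * snd p).

(** In the coordinates (s, y) of strip n, the first coordinate of the chart is a
    parameter along the leaf. Twisting u for the time of this parameter gives
    cot s' = (side u / u) (height s - y), which depends only on the leaf. *)
Definition to_strip (P : strip_profile) (x0 : R) (n : Z) (p : plane) : plane :=
  let q := strip_coords x0 n p in
  let u := half_tan (fst q) in
  let t := bend P u - snd q in (t, twist P t u).

Definition of_strip (P : strip_profile) (x0 : R) (n : Z) (z : plane) : plane :=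
  let u := twist P (- fst z) (snd z) in
  (x0 + IZR n * PI + 2 * atan u, cos (IZR n * PI) * (bend P u - fst z)).

Definition strip (x0 : R) (n : Z) (p : plane) : Prop :=
  - PI < fst p - x0 - IZR n * PI < PI.

Lemma plane_interval_all (x : R) : in_open_interval m_infty p_infty x.
Proof. split; exact I. Qed.

Lemma strip_open x0 n : open (strip x0 n).
Proof.
apply (open_comp (fun p : plane => fst p - x0 - IZR n * PI)
                 (fun s => - PI < s /\ s < PI)).
- intros p _. change (continuous (fun p : plane => fst p - x0 - IZR n * PI) p).
  continuity_of_formula.
- apply open_and; [apply open_gt|apply open_lt].
Qed.

Lemma continuous_strip_coords x0 n p : continuous (strip_coords x0 n) p.
Proof.
unfold strip_coords. continuity_of_formula.
Qed.

Lemma continuous_to_strip P x0 n p : strip x0 n p -> continuous (to_strip P x0 n) p.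
Proof.
intros H.
assert (Hu : continuous (fun q => half_tan (fst (strip_coords x0 n q))) p).
{ unfold half_tan. apply continuous_half; [now apply half_tan_domain| |];
    continuity_of_formula; apply continuous_strip_coords. }
assert (Ht : continuous (fun q => bend P (half_tan (fst (strip_coords x0 n q)))
                                  - snd (strip_coords x0 n q)) p).
{ apply continuous_minus_fct.
  - apply (continuous_comp (fun q => half_tan (fst (strip_coords x0 n q))) (bend P));
      [exact Hu|apply bend_continuous].
  - apply continuous_snd_fct, continuous_strip_coords. }
unfold to_strip. apply continuous_pair; [exact Ht|]. now apply continuous_twist.
Qed.

Lemma continuous_of_strip P x0 n z : continuous (of_strip P x0 n) z.
Proof.
assert (Hu : continuous (fun z : plane => twist P (- fst z) (snd z)) z).
{ apply continuous_twist; continuity_of_formula. }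
unfold of_strip. continuity_of_formula.
apply (continuous_comp (fun z : plane => twist P (- fst z) (snd z)) (bend P));
  [exact Hu|apply bend_continuous].
Qed.

Lemma of_strip_in P x0 n z : strip x0 n (of_strip P x0 n z).
Proof.
unfold strip, of_strip; simpl.
pose proof (angle_2atan_bounds (twist P (- fst z) (snd z))). lra.
Qed.

Lemma to_stripK P x0 n p : strip x0 n p -> of_strip P x0 n (to_strip P x0 n p) = p.
Proof.
intros H. unfold of_strip, to_strip. simpl.
rewrite twist_opp, atan_2half_tan by exact H.
destruct p as [x y]; simpl. f_equal; [ring|].
transitivity (cos (IZR n * PI) * cos (IZR n * PI) * y); [ring|].
rewrite cos_sqr_IZR_PI. ring.
Qed.

Lemma of_stripK P x0 n z : to_strip P x0 n (of_strip P x0 n z) = z.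
Proof.
destruct z as [t z]. unfold of_strip, to_strip. simpl.
replace (x0 + IZR n * PI + 2 * atan (twist P (- t) z) - x0 - IZR n * PI)
  with (2 * atan (twist P (- t) z)) by ring.
rewrite half_tan_2atan. set (u := twist P (- t) z).
replace (bend P u - cos (IZR n * PI) * (cos (IZR n * PI) * (bend P u - t)))
  with (bend P u - cos (IZR n * PI) * cos (IZR n * PI) * (bend P u - t)) by ring.
rewrite cos_sqr_IZR_PI. f_equal; [ring|].
replace (bend P u - 1 * (bend P u - t)) with (- - t) by ring.
apply twist_opp.
Qed.

Definition strip_chart (P : strip_profile) (x0 : R) (n : Z) : foliated_chart := {|
  dom := strip x0 n;
  to_box := to_strip P x0 n;
  of_box := of_strip P x0 n;
  box_a := m_infty; box_b := p_infty; box_c := m_infty; box_d := p_infty;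
  dom_open := strip_open x0 n;
  to_box_in := fun _ _ => conj (plane_interval_all _) (plane_interval_all _);
  of_box_in := fun z _ => of_strip_in P x0 n z;
  to_boxK := to_stripK P x0 n;
  of_boxK := fun z _ => of_stripK P x0 n z;
  to_box_continuous := continuous_to_strip P x0 n;
  of_box_continuous := fun z _ => continuous_of_strip P x0 n z
|}.

(** Two points of a chart are on the same plaque if they satisfy this relation,
    in which the index of the chart does not occur ([strip_chart_plaque]). This
    is why the charts are compatible. *)
Definition aligned (P : strip_profile) (x0 : R) (p q : plane) : Prop :=
  (sin (fst p - x0) = 0 /\ sin (fst q - x0) = 0) \/
  (0 < sin (fst p - x0) * sin (fst q - x0) /\
   snd p - height P (fst p - x0) = snd q - height P (fst q - x0)).

(** The label of a plaque determines, and is determined by, the number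
    y - height s on either side of the central line. *)
Lemma to_strip_equation P x0 n p :
  strip x0 n p ->
  let u := half_tan (fst p - x0 - IZR n * PI) in
  let w := snd (to_strip P x0 n p) in
  (u = 0 /\ w = 0) \/
  (0 < u * w /\
   u * (1 - w ^ 2) = - 2 * w * side P u * (cos (IZR n * PI) *
     (snd p - height P (fst p - x0)))).
Proof.
intros H u w.
assert (Hw : w = twist P (bend P u - cos (IZR n * PI) * snd p) u) by reflexivity.
destruct (Req_dec u 0) as [E|E].
- left. split; [exact E|]. rewrite Hw, E. apply twist_0.
- right. rewrite Hw. split; [now apply twist_sign|].
  rewrite <- twist_equation, <- Hw.
  pose proof (height_half_tan P u E) as K. unfold u at 5 in K.
  rewrite atan_2half_tan, height_shift in K by exact H.
  replace (1 - u ^ 2) with (2 * side P u * (cos (IZR n * PI) * height P (fst p - x0))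
    - 2 * bend P u * side P u) by lra.
  ring.
Qed.

(** The cotangent of an angle, written in terms of the tangent of its half, is
    injective on each of the intervals ]- PI, 0[ and ]0, PI[. *)
Lemma half_slope_injective (u v : R) :
  0 < u * v -> v * (1 - u ^ 2) = u * (1 - v ^ 2) -> u = v.
Proof.
intros H E. assert (K : (u - v) * (1 + u * v) = 0) by nra.
apply Rmult_integral in K. destruct K; lra.
Qed.

Lemma strip_level P x0 n p q :
  strip x0 n p -> strip x0 n q ->
  (snd (to_strip P x0 n p) = snd (to_strip P x0 n q) <-> aligned P x0 p q).
Proof.
intros Hp Hq.
pose proof (to_strip_equation P x0 n p Hp) as Ep.
pose proof (to_strip_equation P x0 n q Hq) as Eq.
destruct (sign_sin_half_tan _ Hp) as [a [Ha Sp]].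
destruct (sign_sin_half_tan _ Hq) as [b [Hb Sq]].
rewrite sin_minus_IZR_PI in Sp, Sq.
pose proof (cos_sqr_IZR_PI n) as Hc.
unfold aligned. cbv zeta in Ep, Eq.
set (u := half_tan (fst p - x0 - IZR n * PI)) in *.
set (v := half_tan (fst q - x0 - IZR n * PI)) in *.
set (w := snd (to_strip P x0 n p)) in *.
set (z := snd (to_strip P x0 n q)) in *.
set (c := cos (IZR n * PI)) in *.
set (sp := sin (fst p - x0)) in *. set (sq := sin (fst q - x0)) in *.
set (A := snd p - height P (fst p - x0)) in *.
set (B := snd q - height P (fst q - x0)) in *.
assert (Sp' : sp = c * (a * u)) by (rewrite <- Sp, <- Rmult_assoc, Hc; ring).
assert (Sq' : sq = c * (b * v)) by (rewrite <- Sq, <- Rmult_assoc, Hc; ring).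
assert (Spq : sp * sq = (a * b) * (u * v)).
{ rewrite Sp', Sq'. transitivity ((c * c) * ((a * b) * (u * v))); [ring|].
  rewrite Hc; ring. }
assert (Hab : 0 < a * b) by nra.
assert (Zp : sp = 0 -> u = 0).
{ intros K. rewrite K in Sp'. assert (c * sp = 0) by (rewrite K; ring).
  rewrite Sp in H. apply Rmult_integral in H. destruct H; lra. }
assert (Zq : sq = 0 -> v = 0).
{ intros K. assert (c * sq = 0) by (rewrite K; ring).
  rewrite Sq in H. apply Rmult_integral in H. destruct H; lra. }
destruct Ep as [[Eu Ew]|[Suw Euw]]; destruct Eq as [[Ev Ez]|[Svz Evz]].
- split; [intros _; left|intros _; congruence].
  rewrite Sp', Sq', Eu, Ev. split; ring.
- split.
  + intros K. rewrite <- K, Ew in Svz. lra.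
  + intros [[_ K]|[K _]]; [rewrite (Zq K) in Svz; lra|].
    rewrite Spq, Eu in K. lra.
- split.
  + intros K. rewrite K, Ez in Suw. lra.
  + intros [[K _]|[K _]]; [rewrite (Zp K) in Suw; lra|].
    rewrite Spq, Ev in K. lra.
- assert (Hu0 : u <> 0) by (intro K; rewrite K in Suw; lra).
  assert (Hv0 : v <> 0) by (intro K; rewrite K in Svz; lra).
  assert (Hc0 : c <> 0) by (intro K; rewrite K in Hc; lra).
  split.
  + intros K. right. rewrite <- K in Svz, Evz.
    assert (Huv : 0 < u * v).
    { assert (0 < (u * w) * (v * w)) by nra. nra. }
    split; [rewrite Spq; nra|].
    pose proof (side_same_sign P u v Huv) as Hs.
    pose proof (side_nonzero P v Hv0) as Hsv.
    assert (Hw0 : w <> 0) by (intro K'; rewrite K' in Suw; lra).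
    assert (Q : (w * side P v * u * c) * (A - B) = 0).
    { replace ((w * side P v * u * c) * (A - B))
        with (w * (side P v * u) * c * A - u * (w * side P v * (c * B))) by ring.
      rewrite <- Hs.
      replace (w * (side P u * v) * c * A) with (v * (w * side P u * (c * A))) by ring.
      assert (E1 : w * side P u * (c * A) = - (u * (1 - w ^ 2)) / 2) by lra.
      assert (E2 : w * side P v * (c * B) = - (v * (1 - w ^ 2)) / 2) by lra.
      rewrite E1, E2. field. }
    apply Rmult_integral in Q. destruct Q as [Q|Q]; [|lra].
    exfalso. clearbody u v w c.
    repeat (apply Rmult_integral in Q; destruct Q as [Q|Q]); contradiction.
  + intros [[K _]|[K1 K2]]; [elim Hu0; auto|].
    assert (Huv : 0 < u * v) by (rewrite Spq in K1; nra).
    assert (Hwz : 0 < w * z).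
    { assert (0 < (u * w) * (v * z)) by nra. nra. }
    apply half_slope_injective; [exact Hwz|].
    rewrite <- K2 in Evz.
    pose proof (side_same_sign P u v Huv) as Hs.
    apply (Rmult_eq_reg_l (u * v)); [|nra].
    transitivity (v * z * (u * (1 - w ^ 2))); [ring|].
    rewrite Euw. transitivity (u * w * (v * (1 - z ^ 2))); [|ring].
    rewrite Evz.
    transitivity (- 2 * w * z * (c * A) * (side P u * v)); [ring|].
    rewrite Hs. ring.
Qed.

(** * Curves in the plane and their velocities *)

Lemma filterdiff_pair {T U V : NormedModule R_AbsRing} (f : T -> U) (g : T -> V)
    (x : T) (lf : T -> U) (lg : T -> V) :
  filterdiff f (locally x) lf -> filterdiff g (locally x) lg ->
  filterdiff (fun t => (f t, g t)) (locally x) (fun t => (lf t, lg t)).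
Proof.
intros Hf Hg.
apply (filterdiff_comp'_2 f g (fun a b => (a, b)) x lf lg (fun a b => (a, b)));
  [exact Hf|exact Hg|].
apply (filterdiff_ext (fun t : prod_NormedModule R_AbsRing U V => t)).
- intros [a b]; reflexivity.
- apply (filterdiff_ext_lin _ (fun t => t)).
  + apply filterdiff_id.
  + intros [a b]; reflexivity.
Qed.

Lemma is_derive_pair (f g : R -> R) (t lf lg : R) :
  is_derive f t lf -> is_derive g t lg ->
  is_derive (fun u => (f u, g u)) t ((lf, lg) : plane).
Proof.
intros Hf Hg. unfold is_derive.
apply (filterdiff_ext_lin _ (fun y : R => (scal y lf, scal y lg) : plane)).
- exact (filterdiff_pair f g t _ _ Hf Hg).
- intros y; reflexivity.
Qed.

Lemma is_derive_fst (c : R -> plane) (t : R) (l : plane) :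
  is_derive c t l -> is_derive (fun u => fst (c u)) t (fst l).
Proof.
intros H. unfold is_derive.
apply (filterdiff_ext_lin _ (fun y : R => fst (scal y l : plane))).
- apply (filterdiff_comp' c fst); [exact H|].
  apply filterdiff_linear, is_linear_fst.
- intros y; reflexivity.
Qed.

Lemma is_derive_snd (c : R -> plane) (t : R) (l : plane) :
  is_derive c t l -> is_derive (fun u => snd (c u)) t (snd l).
Proof.
intros H. unfold is_derive.
apply (filterdiff_ext_lin _ (fun y : R => snd (scal y l : plane))).
- apply (filterdiff_comp' c snd); [exact H|].
  apply filterdiff_linear, is_linear_snd.
- intros y; reflexivity.
Qed.

Lemma is_derive_R_unique (f : R -> R) (t a b : R) :
  is_derive f t a -> is_derive f t b -> a = b.
Proof.
intros Ha Hb. now rewrite <- (is_derive_unique _ _ _ Ha), <- (is_derive_unique _ _ _ Hb).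
Qed.

Lemma foliation_tangent_vector (Fol : foliation) (p : plane) :
  exists v, v <> (0, 0) /\ tangent Fol p v.
Proof.
destruct (atlas_cover Fol p) as [k [Hk Hp]].
destruct (plaques_C1 Fol k p Hk Hp) as [a [b [c [c' [Hc [Hn [_ Hpl]]]]]]].
destruct (proj1 (Hpl p)) as [t0 [[Ha Hb] E]]; [split; [|split]; auto|].
exists (c' t0). split; [apply Hn; now split|].
assert (L : exists eps, 0 < eps /\ forall t, - eps < t < eps ->
  in_open_interval a b (t0 + t)).
{ assert (La : exists e, 0 < e /\ forall t, - e < t < e -> Rbar_lt a (t0 + t)).
  { destruct a as [a| |]; simpl in Ha.
    - exists (t0 - a). split; [lra|]. intros t Ht. simpl. lra.
    - contradiction.
    - exists 1. split; [lra|]. intros; exact I. }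
  assert (Lb : exists e, 0 < e /\ forall t, - e < t < e -> Rbar_lt (t0 + t) b).
  { destruct b as [b| |]; simpl in Hb.
    - exists (b - t0). split; [lra|]. intros t Ht. simpl. lra.
    - exists 1. split; [lra|]. intros; exact I.
    - contradiction. }
  destruct La as [e1 [He1 L1]]. destruct Lb as [e2 [He2 L2]].
  exists (Rmin e1 e2). split; [now apply Rmin_pos|]. intros t Ht.
  pose proof (Rmin_l e1 e2). pose proof (Rmin_r e1 e2).
  split; [apply L1|apply L2]; lra. }
destruct L as [eps [Heps L]].
exists k, eps, (fun t => c (t0 + t)), (fun t => c' (t0 + t)).
rewrite Rplus_0_r. split; [exact Hk|]. split; [exact Heps|]. split.
- intros t Ht. apply L in Ht. destruct (Hc _ Ht) as [D C]. 
  assert (D2 : is_derive (fun t => t0 + t) t 1) by (auto_derive; [exact I|ring]).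
  split.
  + rewrite <- (scal_one (c' (t0 + t))).
    now apply (is_derive_comp c (fun t => t0 + t)).
  + apply (continuous_comp (fun t => t0 + t) c'); [|exact C]. continuity_of_formula.
- split; [exact E|]. split; [reflexivity|]. intros t Ht. apply Hpl.
  exists (t0 + t). split; [now apply L|reflexivity].
Qed.

(** * The foliation defined by a profile *)

Lemma strip_sign x0 n p q :
  strip x0 n p -> strip x0 n q ->
  let u := fst p - x0 - IZR n * PI in
  let v := fst q - x0 - IZR n * PI in
  (sin (fst p - x0) = 0 <-> u = 0) /\
  (0 < sin (fst p - x0) * sin (fst q - x0) <-> 0 < u * v).
Proof.
intros Hp Hq u v.
assert (Hsin : forall a, - PI < a < PI ->
  (a = 0 /\ sin a = 0) \/ (0 < a /\ 0 < sin a) \/ (a < 0 /\ sin a < 0)).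
{ intros a Ha. destruct (Rtotal_order a 0) as [L|[L|L]].
  - right; right. split; [exact L|]. apply sin_lt_0_var; lra.
  - left. rewrite L. split; [reflexivity|apply sin_0].
  - right; left. split; [exact L|]. apply sin_gt_0; lra. }
pose proof (Hsin u Hp) as Ku. pose proof (Hsin v Hq) as Kv.
pose proof (cos_sqr_IZR_PI n) as Hc.
assert (Ep : sin u = cos (IZR n * PI) * sin (fst p - x0))
  by apply sin_minus_IZR_PI.
assert (Eq : sin v = cos (IZR n * PI) * sin (fst q - x0))
  by apply sin_minus_IZR_PI.
assert (Epq : sin (fst p - x0) * sin (fst q - x0) = sin u * sin v).
{ rewrite Ep, Eq. set (c := cos (IZR n * PI)) in *.
  transitivity ((c * c) * (sin (fst p - x0) * sin (fst q - x0))); [|ring].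
  rewrite Hc; ring. }
rewrite Epq. split.
- split.
  + intros K. rewrite K in Ep. lra.
  + intros K. rewrite K, sin_0 in Ep. symmetry in Ep.
    apply Rmult_integral in Ep. destruct Ep as [Ep|Ep]; [|exact Ep].
    rewrite Ep in Hc. lra.
- split; intros K; nra.
Qed.

Lemma strip_chart_plaque P x0 n p q :
  plaque (strip_chart P x0 n) p q <->
  strip x0 n p /\ strip x0 n q /\ aligned P x0 p q.
Proof.
unfold plaque; simpl. split; intros [Hp [Hq H]]; (split; [exact Hp|]);
  (split; [exact Hq|]); now apply (strip_level P x0 n p q Hp Hq).
Qed.

Definition strip_atlas (P : strip_profile) (x0 : R) (k : foliated_chart) : Prop :=
  exists n : Z, k = strip_chart P x0 n.

Lemma strip_atlas_cover P x0 p : exists k, strip_atlas P x0 k /\ dom k p.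
Proof.
pose proof PI_RGT_0 as Hpi.
destruct (archimed ((fst p - x0) / PI)) as [H1 H2].
set (n := up ((fst p - x0) / PI)) in *.
exists (strip_chart P x0 (n - 1)). split; [now exists (n - 1)%Z|].
simpl. unfold strip. rewrite minus_IZR.
set (r := (fst p - x0) / PI) in *.
assert (E : fst p - x0 = r * PI) by (unfold r; field; lra).
rewrite E. nra.
Qed.

Lemma strip_charts_compatible P x0 k1 k2 p :
  strip_atlas P x0 k1 -> strip_atlas P x0 k2 -> dom k1 p -> dom k2 p ->
  exists W : plane -> Prop, open W /\ W p /\
    (forall q, W q -> dom k1 q /\ dom k2 q) /\
    (forall q r, W q -> W r -> (plaque k1 q r <-> plaque k2 q r)).
Proof.
intros [n1 ->] [n2 ->] H1 H2.
exists (fun q => strip x0 n1 q /\ strip x0 n2 q).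
split; [apply open_and; apply strip_open|].
split; [now split|]. split; [now intros q Hq|].
intros q r [Hq1 Hq2] [Hr1 Hr2]. rewrite !strip_chart_plaque. tauto.
Qed.

(** A plaque is either a vertical line, parametrized by the height, or a graph
    over one of the two halves of the interval under the strip, parametrized by
    the abscissa. The chart itself need not be differentiable. *)
Lemma strip_plaques_C1 P x0 k p :
  strip_atlas P x0 k -> dom k p ->
  exists (a b : Rbar) (c c' : R -> plane),
    C1_curve a b c c' /\
    (forall t, in_open_interval a b t -> c' t <> (0, 0)) /\
    (forall t u, in_open_interval a b t -> in_open_interval a b u ->
       c t = c u -> t = u) /\
    (forall q, plaque k p q <-> exists t, in_open_interval a b t /\ c t = q).
Proof.
intros [n ->] Hp. change (strip x0 n p) in Hp.
pose proof PI_RGT_0 as Hpi.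
destruct (Req_dec (fst p - x0 - IZR n * PI) 0) as [E|E].
- exists m_infty, p_infty, (fun t => (fst p, t)), (fun _ => (0, 1)).
  split; [|split; [|split]].
  + intros t _. split; [|apply continuous_const].
    apply is_derive_pair; auto_derive; reflexivity || exact I.
  + intros t _ K. injection K. lra.
  + intros t u _ _ K. now injection K.
  + intros q. rewrite strip_chart_plaque. split.
    * intros [_ [Hq H]]. exists (snd q). split; [apply plane_interval_all|].
      destruct (strip_sign x0 n p p Hp Hp) as [Zp _].
      destruct (strip_sign x0 n q q Hq Hq) as [Zq _].
      apply Zp in E.
      destruct H as [[_ K]|[K _]]; [|rewrite E in K; lra].
      apply Zq in K. apply Zp in E.
      rewrite (surjective_pairing q) at 2. f_equal. lra.
    * intros [t [_ <-]].
      assert (Hq : strip x0 n (fst p, t)) by exact Hp.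
      split; [exact Hp|]. split; [exact Hq|]. left. simpl.
      apply (strip_sign x0 n p p Hp Hp) in E. now split.
- set (u := fst p - x0 - IZR n * PI) in *.
  (* The plaque of p lies over ]a, a + PI[, the half of the strip containing p. *)
  set (e := if Rlt_dec 0 u then 0 else -1).
  set (H0 := snd p - height P (fst p - x0)).
  set (a := x0 + IZR n * PI + e * PI).
  assert (Ha : forall x, a < x < a + PI <->
     - PI < x - x0 - IZR n * PI < PI /\ 0 < u * (x - x0 - IZR n * PI)).
  { intros x. unfold a, e. set (v := x - x0 - IZR n * PI).
    replace x with (v + x0 + IZR n * PI) by (unfold v; ring).
    destruct (Rlt_dec 0 u) as [L|L].
    - split; [intros K; split; [lra|]|intros [K1 K2]].
      + apply Rmult_lt_0_compat; lra.
      + split; [|lra]. assert (0 < v) by nra. lra.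
    - assert (L' : u < 0) by lra.
      split; [intros K; split; [lra|]|intros [K1 K2]].
      + nra.
      + split; [lra|]. assert (v < 0) by nra. lra. }
  assert (Hin : forall x, in_open_interval a (a + PI) x <-> a < x < a + PI)
    by (intros x; reflexivity).
  assert (Hs : forall x, a < x < a + PI ->
    strip x0 n (x, height P (x - x0) + H0) /\
    0 < sin (fst p - x0) * sin (x - x0)).
  { intros x K. apply Ha in K. destruct K as [K1 K2].
    assert (Hq : strip x0 n (x, height P (x - x0) + H0)) by exact K1.
    split; [exact Hq|]. now apply (strip_sign x0 n p _ Hp Hq). }
  assert (Hs0 : forall x, a < x < a + PI -> sin (x - x0) <> 0).
  { intros x K K'. destruct (Hs x K) as [_ S]. rewrite K' in S. lra. }
  exists a, (a + PI), (fun x => (x, height P (x - x0) + H0)),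
    (fun x => (1, slope_num P (x - x0) / slope_den P (x - x0))).
  split; [|split; [|split]].
  + intros x K. apply Hin in K. split.
    * apply is_derive_pair; [auto_derive; reflexivity || exact I|].
      pose proof (height_derive P (x - x0) (Hs0 x K)) as D.
      assert (D2 : is_derive (fun x => x - x0) x 1) by (auto_derive; [exact I|ring]).
      pose proof (is_derive_comp (height P) (fun x => x - x0) x _ _ D D2) as D3.
      pose proof (is_derive_plus _ (fun _ => H0) x _ _ D3
        (@is_derive_const R_AbsRing R_NormedModule H0 x)) as D4.
      replace (slope_num P (x - x0) / slope_den P (x - x0)) with
        (plus (scal 1 (slope_num P (x - x0) / slope_den P (x - x0))) zero);
        [exact D4|].
      unfold plus, scal, zero; simpl. unfold mult; simpl. ring.
    * apply continuous_pair; [apply continuous_const|].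
      assert (C : continuous (fun x => x - x0) x) by continuity_of_formula.
      apply continuous_div_fct.
      -- intros K'. apply slope_den_zero in K'. now apply (Hs0 x K).
      -- apply (continuous_comp (fun x => x - x0) (slope_num P)); [exact C|].
         apply slope_num_continuous.
      -- apply (continuous_comp (fun x => x - x0) (slope_den P)); [exact C|].
         apply slope_den_continuous.
  + intros t _ K. injection K. lra.
  + intros t w _ _ K. now injection K.
  + intros q. rewrite strip_chart_plaque. split.
    * intros [_ [Hq H]]. exists (fst q).
      destruct (strip_sign x0 n p q Hp Hq) as [Zp Zpq].
      destruct H as [[K _]|[K1 K2]]; [apply Zp in K; contradiction|].
      split.
      -- apply Hin, Ha. split; [exact Hq|]. now apply Zpq.
      -- rewrite (surjective_pairing q) at 3. f_equal. unfold H0. lra.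
    * intros [x [K <-]]. apply Hin in K.
      destruct (Hs x K) as [K1 K2]. split; [exact Hp|]. split; [exact K1|].
      right. split; [exact K2|]. simpl. unfold H0. lra.
Qed.

Definition strip_foliation (P : strip_profile) (x0 : R) : foliation := {|
  atlas := strip_atlas P x0;
  atlas_cover := strip_atlas_cover P x0;
  charts_compatible := strip_charts_compatible P x0;
  plaques_C1 := strip_plaques_C1 P x0
|}.

(** Along a curve in a plaque, either the abscissa is constant, or y - height is
    constant: differentiate. *)
Lemma strip_foliation_tangent P x0 p v :
  tangent (strip_foliation P x0) p v ->
  slope_den P (fst p - x0) * snd v = slope_num P (fst p - x0) * fst v.
Proof.
intros [k [eps [c [c' [[n ->] [Heps [Hc [<- [<- Hpl]]]]]]]]].
assert (Hpl' : forall t, - eps < t < eps ->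
  strip x0 n (c 0) /\ strip x0 n (c t) /\ aligned P x0 (c 0) (c t)).
{ intros t Ht. now apply strip_chart_plaque, Hpl. }
assert (H0 : in_open_interval (- eps) eps 0) by (split; simpl; lra).
destruct (Hc 0 H0) as [D _].
pose proof (is_derive_fst _ _ _ D) as D1.
pose proof (is_derive_snd _ _ _ D) as D2.
assert (Near : locally 0 (fun t => - eps < t < eps)).
{ exists (mkposreal eps Heps). intros t Ht.
  change (Rabs (t - 0) < eps) in Ht. apply Rabs_def2 in Ht. lra. }
destruct (Req_dec (sin (fst (c 0) - x0)) 0) as [E|E].
- assert (C1 : is_derive (fun t => fst (c t)) 0 0).
  { apply (is_derive_ext_loc (fun _ => fst (c 0))); [|apply @is_derive_const].
    revert Near; apply filter_imp; intros t Ht.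
    destruct (Hpl' t Ht) as [Sp [Sq A]].
    destruct (strip_sign x0 n _ _ Sp Sp) as [Zp _].
    destruct (strip_sign x0 n _ _ Sq Sq) as [Zq _].
    destruct A as [[_ A]|[A _]]; [|rewrite E in A; lra].
    apply Zp in E. apply Zq in A. lra. }
  assert (E' : slope_den P (fst (c 0) - x0) = 0) by now apply slope_den_zero.
  rewrite E', (is_derive_R_unique _ _ _ _ D1 C1). ring.
- pose proof (height_derive P _ E) as Dh.
  assert (D3 : is_derive (fun t => fst (c t) - x0) 0 (fst (c' 0))).
  { replace (fst (c' 0)) with (fst (c' 0) - 0) by ring.
    apply @is_derive_minus; [exact D1|apply @is_derive_const]. }
  pose proof (is_derive_comp (height P) (fun t => fst (c t) - x0) 0 _ _ Dh D3) as D4.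
  assert (D5 : is_derive (fun t => snd (c t) - height P (fst (c t) - x0)) 0
    (snd (c' 0) - fst (c' 0) *
       (slope_num P (fst (c 0) - x0) / slope_den P (fst (c 0) - x0))))
    by exact (is_derive_minus _ _ 0 _ _ D2 D4).
  assert (C1 : is_derive (fun t => snd (c t) - height P (fst (c t) - x0)) 0 0).
  { apply (is_derive_ext_loc (fun _ => snd (c 0) - height P (fst (c 0) - x0)));
      [|apply @is_derive_const].
    revert Near; apply filter_imp; intros t Ht.
    destruct (Hpl' t Ht) as [_ [_ A]].
    destruct A as [[A _]|[_ A]]; [contradiction|exact A]. }
  assert (Hd : slope_den P (fst (c 0) - x0) <> 0)
    by (intro K; apply slope_den_zero in K; contradiction).
  pose proof (is_derive_R_unique _ _ _ _ C1 D5) as K.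
  replace (snd (c' 0)) with (fst (c' 0) *
     (slope_num P (fst (c 0) - x0) / slope_den P (fst (c 0) - x0))) by lra.
  field. exact Hd.
Qed.

(** * Glide reflections *)

Definition glide (n : Z) (p : plane) : plane :=
  (fst p + IZR n * PI, cos (IZR n * PI) * snd p).

Lemma glide_comp m n p : glide m (glide n p) = glide (m + n) p.
Proof.
unfold glide; simpl. rewrite plus_IZR, Rmult_plus_distr_r, cos_plus, !sin_IZR_PI.
f_equal; ring.
Qed.

Lemma glide_0 p : glide 0 p = p.
Proof.
unfold glide. destruct p; simpl. rewrite Rmult_0_l, cos_0. f_equal; ring.
Qed.

Lemma strip_coords_glide x0 m n p :
  strip_coords x0 (m + n) (glide m p) = strip_coords x0 n p.
Proof.
unfold strip_coords, glide; simpl.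
rewrite plus_IZR, Rmult_plus_distr_r, cos_plus, !sin_IZR_PI. f_equal; [ring|].
transitivity (cos (IZR m * PI) * cos (IZR m * PI) * (cos (IZR n * PI) * snd p));
  [ring|]. rewrite cos_sqr_IZR_PI. ring.
Qed.

Lemma glide_fixed_point_free p : glide 1 p <> p.
Proof.
intros H. apply (f_equal fst) in H. unfold glide in H; simpl in H.
pose proof PI_RGT_0. lra.
Qed.

(** A glide reflection by m sends chart n to chart m + n. *)
Lemma glide_plaque P x0 m n p q :
  plaque (strip_chart P x0 n) p q ->
  plaque (strip_chart P x0 (m + n)) (glide m p) (glide m q).
Proof.
assert (Hs : forall r, strip x0 n r -> strip x0 (m + n) (glide m r)).
{ intros r Hr. change (- PI < fst (strip_coords x0 (m + n) (glide m r)) < PI).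
  now rewrite strip_coords_glide. }
intros [Hp [Hq H]]. split; [now apply Hs|]. split; [now apply Hs|].
change (snd (to_strip P x0 (m + n) (glide m p)) =
        snd (to_strip P x0 (m + n) (glide m q))).
unfold to_strip. rewrite !strip_coords_glide. exact H.
Qed.

Lemma glide_leaf P x0 m p q :
  leaf (strip_foliation P x0) p q ->
  leaf (strip_foliation P x0) (glide m p) (glide m q).
Proof.
intros H; induction H as [p q [k [[n ->] H]]|p|p q r _ IH1 _ IH2].
- apply rt_step. exists (strip_chart P x0 (m + n)). split; [now exists (m + n)%Z|].
  now apply glide_plaque.
- apply rt_refl.
- now apply rt_trans with (glide m q).
Qed.

Lemma glide_preserves P x0 m : preserves (glide m) (strip_foliation P x0).
Proof.
intros p. exists (glide m p). intros r. split.
- intros H. exists (glide (- m) r). split.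
  + rewrite <- (glide_0 p). replace 0%Z with (- m + m)%Z by ring.
    rewrite <- glide_comp. now apply glide_leaf.
  + rewrite glide_comp. replace (m + - m)%Z with 0%Z by ring. apply glide_0.
- intros [r' [H <-]]. now apply glide_leaf.
Qed.

(** * The two foliations and the metric *)

(** The leaves are asymptotic to the line s = 0 upwards on its right and
    downwards on its left. *)
Definition stable_profile : strip_profile.
Proof.
refine {|
  side := fun u => u;
  bend := fun u => u;
  height := fun s => / sin s;
  slope_num := fun s => - cos s;
  slope_den := fun s => sin s ^ 2
|}.
- intros u. apply continuous_id.
- reflexivity.
- intros u w _. ring.
- auto.
- intros u. apply continuous_id.
- intros u Hu. rewrite sin_2atan. field. split; nra.
- intros n s. rewrite sin_minus_IZR_PI, Rinv_mult.
  destruct (cos_IZR_PI_cases n) as [->| ->]; [now rewrite Rinv_1|].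
  replace (/ -1) with (- 1) by field. reflexivity.
- intros s Hs. auto_derive; [exact Hs|]. field. exact Hs.
- intros s. continuity_of_formula.
- intros s. continuity_of_formula.
- intros s. split; intros H; [nra|]. rewrite H. ring.
Defined.

(** The leaves are asymptotic to the line s = 0 upwards on both sides. *)
Definition unstable_profile : strip_profile.
Proof.
refine {|
  side := Rabs;
  bend := fun _ => 0;
  height := fun s => cos s / Rabs (sin s);
  slope_num := fun _ => - 1;
  slope_den := fun s => sin s * Rabs (sin s)
|}.
- intros u. apply continuous_Rabs.
- apply Rabs_R0.
- intros u w H. unfold Rabs.
  destruct (Rcase_abs u); destruct (Rcase_abs w); nra.
- intros u. apply Rabs_no_R0.
- intros u. apply continuous_const.
- intros u Hu. rewrite cos_2atan, sin_2atan.
  assert (H : 0 < 1 + u ^ 2) by nra.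
  unfold Rdiv. rewrite !Rabs_mult, (Rabs_pos_eq 2) by lra.
  rewrite (Rabs_pos_eq (/ (1 + u ^ 2))) by (left; now apply Rinv_0_lt_compat).
  pose proof (Rabs_no_R0 u Hu). field. split; lra.
- intros n s. rewrite sin_minus_IZR_PI, cos_minus_IZR_PI, Rabs_mult.
  rewrite Rabs_cos_IZR_PI, Rmult_1_l. unfold Rdiv. ring.
- intros s Hs.
  destruct (Rtotal_order (sin s) 0) as [L|[L|L]]; [|contradiction|].
  + apply (is_derive_ext_loc (fun s => cos s / - sin s)).
    * assert (N : locally s (fun t => sin t < 0)).
      { apply (continuous_sin_fct (fun t => t) s (continuous_id s) (fun y => y < 0)).
        now apply (open_lt 0). }
      revert N; apply filter_imp; intros t Ht. now rewrite (Rabs_left (sin t)).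
    * rewrite (Rabs_left (sin s)) by exact L. auto_derive; [lra|].
      pose proof (sin2_cos2 s) as K. unfold Rsqr in K.
      replace (sin s * - sin s) with (- (sin s * sin s)) by ring.
      field_simplify; [|lra|lra]. 
      replace (cos s ^ 2) with (1 - sin s * sin s) by lra. field. lra.
  + apply (is_derive_ext_loc (fun s => cos s / sin s)).
    * assert (N : locally s (fun t => 0 < sin t)).
      { apply (continuous_sin_fct (fun t => t) s (continuous_id s) (fun y => 0 < y)).
        now apply (open_gt 0). }
      revert N; apply filter_imp; intros t Ht. now rewrite (Rabs_pos_eq (sin t)) by lra.
    * rewrite (Rabs_pos_eq (sin s)) by lra. auto_derive; [lra|].
      pose proof (sin2_cos2 s) as K. unfold Rsqr in K.
      field_simplify; [|lra|lra].
      replace (cos s ^ 2) with (1 - sin s * sin s) by lra. field. lra.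
- intros s. continuity_of_formula.
- intros s. continuity_of_formula.
- intros s. split; intros H.
  + apply Rmult_integral in H. destruct H as [H|H]; [exact H|].
    revert H. unfold Rabs. destruct (Rcase_abs (sin s)); lra.
  + rewrite H. ring.
Defined.

Definition stable_foliation := strip_foliation stable_profile 0.
Definition unstable_foliation := strip_foliation unstable_profile (PI / 2).

(** Each form is named after the foliation on which it vanishes. So
    [unstable_form] measures the stable component of a vector, and
    [stable_form] the unstable one. *)
Definition unstable_form (x : R) (v : plane) : R :=
  fst v - cos x * Rabs (cos x) * snd v.
Definition stable_form (x : R) (v : plane) : R :=
  cos x * fst v + sin x ^ 2 * snd v.

Lemma stable_tangent p v :
  tangent stable_foliation p v -> stable_form (fst p) v = 0.
Proof.
intros H. apply strip_foliation_tangent in H. simpl in H.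
rewrite Rminus_0_r in H. unfold stable_form. simpl. lra.
Qed.

Lemma unstable_tangent p v :
  tangent unstable_foliation p v -> unstable_form (fst p) v = 0.
Proof.
intros H. apply strip_foliation_tangent in H. simpl in H.
replace (sin (fst p - PI / 2)) with (- cos (fst p)) in H.
- rewrite Rabs_Ropp in H. unfold unstable_form. lra.
- rewrite sin_minus, sin_PI2, cos_PI2. ring.
Qed.

(** The determinant of the fields (sin^2 x, - cos x) and (cos x |cos x|, 1). Its
    positivity is the transversality of the foliations; the lower bound is used
    to estimate the components of a vector. *)
Definition frame_det (x : R) : R := sin x ^ 2 + cos x ^ 2 * Rabs (cos x).

Lemma frame_det_bound (x : R) : 3 / 4 <= frame_det x.
Proof.
unfold frame_det. pose proof (sin2_cos2 x) as K. unfold Rsqr in K.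
pose proof (Rabs_pos (cos x)). rewrite <- (pow2_abs (cos x)).
assert (E : cos x * cos x = Rabs (cos x) ^ 2) by (rewrite pow2_abs; ring).
set (c := Rabs (cos x)) in *.
replace (sin x ^ 2) with (1 - c ^ 2) by lra.
assert (0 <= (c - 2 / 3) ^ 2 * (c + 1 / 3))
  by (apply Rmult_le_pos; [apply pow2_ge_0|lra]).
replace (1 - c ^ 2 + c ^ 2 * c) with (1 - 4 / 27 + (c - 2 / 3) ^ 2 * (c + 1 / 3))
  by field.
lra.
Qed.

Lemma frame_fst x v :
  frame_det x * fst v =
  sin x ^ 2 * unstable_form x v + cos x * Rabs (cos x) * stable_form x v.
Proof. unfold frame_det, unstable_form, stable_form. ring. Qed.

Lemma frame_snd x v :
  frame_det x * snd v = stable_form x v - cos x * unstable_form x v.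
Proof. unfold frame_det, unstable_form, stable_form. ring. Qed.

Lemma forms_independent x v :
  unstable_form x v = 0 -> stable_form x v = 0 -> v = (0, 0).
Proof.
intros Hu Hs. pose proof (frame_det_bound x) as D.
pose proof (frame_fst x v) as E1. pose proof (frame_snd x v) as E2.
rewrite Hu, Hs in E1, E2. rewrite (surjective_pairing v). f_equal.
- apply (Rmult_eq_reg_l (frame_det x)); lra.
- apply (Rmult_eq_reg_l (frame_det x)); lra.
Qed.

Lemma foliations_transversal : transversal unstable_foliation stable_foliation.
Proof.
intros p H.
destruct (foliation_tangent_vector stable_foliation p) as [v [Hv Ht]].
apply Hv, (forms_independent (fst p)).
- now apply unstable_tangent, H.
- now apply stable_tangent.
Qed.

Lemma metric_as_forms x (v : plane) :
  (exp (- x) ^ 2 + exp x ^ 2 * cos x ^ 2) * fst v ^ 2 +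
  2 * (exp x ^ 2 * cos x * sin x ^ 2 - exp (- x) ^ 2 * cos x * Rabs (cos x))
    * fst v * snd v +
  (exp (- x) ^ 2 * (cos x * Rabs (cos x)) ^ 2 + exp x ^ 2 * sin x ^ 4) * snd v ^ 2 =
  (exp (- x) * unstable_form x v) ^ 2 + (exp x * stable_form x v) ^ 2.
Proof. unfold unstable_form, stable_form. ring. Qed.

Definition anosov_metric : riemannian_metric.
Proof.
refine {|
  g11 := fun p => exp (- fst p) ^ 2 + exp (fst p) ^ 2 * cos (fst p) ^ 2;
  g12 := fun p => exp (fst p) ^ 2 * cos (fst p) * sin (fst p) ^ 2
                  - exp (- fst p) ^ 2 * cos (fst p) * Rabs (cos (fst p));
  g22 := fun p => exp (- fst p) ^ 2 * (cos (fst p) * Rabs (cos (fst p))) ^ 2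
                  + exp (fst p) ^ 2 * sin (fst p) ^ 4
|}.
- intros p. continuity_of_formula.
- intros p. continuity_of_formula.
- intros p. continuity_of_formula.
- intros p v Hv. rewrite metric_as_forms.
  set (a := unstable_form (fst p) v). set (b := stable_form (fst p) v).
  pose proof (exp_pos (fst p)). pose proof (exp_pos (- fst p)).
  pose proof (pow2_ge_0 (exp (- fst p) * a)). pose proof (pow2_ge_0 (exp (fst p) * b)).
  destruct (Req_dec a 0) as [Ea|Ea].
  + destruct (Req_dec b 0) as [Eb|Eb].
    * elim Hv. now apply (forms_independent (fst p)).
    * assert (0 < (exp (fst p) * b) ^ 2); [|lra].
      apply pow2_gt_0, Rmult_integral_contrapositive_currified; [lra|exact Eb].
  + assert (0 < (exp (- fst p) * a) ^ 2); [|lra].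
    apply pow2_gt_0, Rmult_integral_contrapositive_currified; [lra|exact Ea].
Defined.

Lemma anosov_norm p v :
  mnorm anosov_metric p v =
  sqrt ((exp (- fst p) * unstable_form (fst p) v) ^ 2
        + (exp (fst p) * stable_form (fst p) v) ^ 2).
Proof. unfold mnorm, anosov_metric, g11, g12, g22. now rewrite metric_as_forms. Qed.

Lemma unstable_form_glide n p v :
  unstable_form (fst (glide n p)) (fst v, cos (IZR n * PI) * snd v) =
  unstable_form (fst p) v.
Proof.
unfold unstable_form, glide; simpl.
rewrite cos_plus, sin_IZR_PI, Rmult_0_r, Rminus_0_r.
destruct (cos_IZR_PI_cases n) as [->| ->].
- rewrite Rmult_1_r. ring.
- replace (cos (fst p) * -1) with (- cos (fst p)) by ring. rewrite Rabs_Ropp. ring.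
Qed.

Lemma stable_form_glide n p v :
  stable_form (fst (glide n p)) (fst v, cos (IZR n * PI) * snd v) =
  cos (IZR n * PI) * stable_form (fst p) v.
Proof.
unfold stable_form, glide; simpl.
rewrite cos_plus, sin_plus, sin_IZR_PI.
destruct (cos_IZR_PI_cases n) as [->| ->]; ring.
Qed.

(** * Expansion and contraction *)

Lemma anosov_norm_unstable p v :
  unstable_form (fst p) v = 0 ->
  mnorm anosov_metric p v = exp (fst p) * Rabs (stable_form (fst p) v).
Proof.
intros H. rewrite anosov_norm, H.
replace ((exp (- fst p) * 0) ^ 2 + (exp (fst p) * stable_form (fst p) v) ^ 2)
  with (Rsqr (exp (fst p) * stable_form (fst p) v)) by (unfold Rsqr; ring).
rewrite sqrt_Rsqr_abs, Rabs_mult, (Rabs_pos_eq (exp _)); [reflexivity|].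
left; apply exp_pos.
Qed.

Lemma anosov_norm_stable p v :
  stable_form (fst p) v = 0 ->
  mnorm anosov_metric p v = exp (- fst p) * Rabs (unstable_form (fst p) v).
Proof.
intros H. rewrite anosov_norm, H.
replace ((exp (- fst p) * unstable_form (fst p) v) ^ 2 + (exp (fst p) * 0) ^ 2)
  with (Rsqr (exp (- fst p) * unstable_form (fst p) v)) by (unfold Rsqr; ring).
rewrite sqrt_Rsqr_abs, Rabs_mult, (Rabs_pos_eq (exp _)); [reflexivity|].
left; apply exp_pos.
Qed.

Lemma glide_filterdiff n (p : plane) :
  filterdiff (glide n) (locally p)
    (fun v : plane => (fst v, cos (IZR n * PI) * snd v) : plane).
Proof.
pose (T := prod_NormedModule R_AbsRing R_NormedModule R_NormedModule).
apply (@filterdiff_pair T R_NormedModule R_NormedModule).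
- apply (filterdiff_ext_lin _ (fun v : plane => plus (fst v) zero)).
  + apply (@filterdiff_plus_fct R_AbsRing T R_NormedModule).
    * apply filter_filter.
    * apply filterdiff_linear, is_linear_fst.
    * apply (@filterdiff_const R_AbsRing T R_NormedModule), filter_filter.
  + intros v. apply plus_zero_r.
- apply (@filterdiff_scal_r_fct R_AbsRing T R_NormedModule).
  + apply filter_filter.
  + intros; apply Rmult_comm.
  + apply filterdiff_linear, is_linear_snd.
Qed.

Lemma is_derive_affine (a b t : R) : is_derive (fun t => a + t * b) t b.
Proof. auto_derive; [exact I|ring]. Qed.

(** Both differentials give the velocity of the image of a line. *)
Lemma filterdiff_unique (f : plane -> plane) (p : plane) (D1 D2 : plane -> plane) :
  filterdiff f (locally p) D1 -> filterdiff f (locally p) D2 ->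
  forall v, D1 v = D2 v.
Proof.
assert (K : forall D v, filterdiff f (locally p) D ->
  is_derive (fun t : R => f (fst p + t * fst v, snd p + t * snd v)) 0 (D v : plane)).
{ intros D v H. unfold is_derive.
  apply (filterdiff_ext_lin _ (fun t : R => D (scal t v : plane))).
  - apply (filterdiff_comp' (fun t : R => (fst p + t * fst v, snd p + t * snd v) : plane) f).
    + apply (is_derive_pair (fun t => fst p + t * fst v) (fun t => snd p + t * snd v)).
      * apply is_derive_affine.
      * apply is_derive_affine.
    + rewrite !Rmult_0_l, !Rplus_0_r, <- surjective_pairing. exact H.
  - intros t. destruct H as [L _]. apply (linear_scal D L). }
intros H1 H2 v. rewrite (surjective_pairing (D1 v)), (surjective_pairing (D2 v)).
pose proof (K D1 v H1) as K1. pose proof (K D2 v H2) as K2.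
f_equal; eapply is_derive_R_unique.
- exact (is_derive_fst _ _ _ K1).
- exact (is_derive_fst _ _ _ K2).
- exact (is_derive_snd _ _ _ K1).
- exact (is_derive_snd _ _ _ K2).
Qed.

Lemma iter_glide n p : Nat.iter n (glide 1) p = glide (Z.of_nat n) p.
Proof.
induction n as [|n IH]; simpl Nat.iter.
- now rewrite glide_0.
- rewrite IH, glide_comp. f_equal. lia.
Qed.

Lemma iter_glide_differential n p D v :
  filterdiff (Nat.iter n (glide 1)) (locally p) D ->
  D v = (fst v, cos (IZR (Z.of_nat n) * PI) * snd v).
Proof.
intros H.
apply (filterdiff_unique (glide (Z.of_nat n)) p D
  (fun v : plane => (fst v, cos (IZR (Z.of_nat n) * PI) * snd v))).
- apply (filterdiff_ext (Nat.iter n (glide 1))); [|exact H].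
  intros q. apply iter_glide.
- apply glide_filterdiff.
Qed.

Lemma glide_expands : expands (glide 1) anosov_metric unstable_foliation 1 PI.
Proof.
intros n p v D Hv HD.
rewrite (iter_glide_differential n p D v HD), iter_glide.
apply unstable_tangent in Hv.
rewrite !anosov_norm_unstable, stable_form_glide, Rabs_mult;
  [|exact Hv|now rewrite unstable_form_glide].
rewrite Rabs_cos_IZR_PI. unfold glide; simpl fst.
rewrite exp_plus, <- INR_IZR_INZ, (Rmult_comm (INR n)).
apply Req_ge. field.
Qed.

Lemma glide_contracts : contracts (glide 1) anosov_metric stable_foliation 1 PI.
Proof.
intros n p v D Hv HD.
rewrite (iter_glide_differential n p D v HD), iter_glide.
apply stable_tangent in Hv.
rewrite !anosov_norm_stable, unstable_form_glide;
  [|exact Hv|rewrite stable_form_glide, Hv; ring].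
unfold glide; simpl fst.
replace (- (fst p + IZR (Z.of_nat n) * PI))
  with (- fst p + - PI * INR n) by (rewrite <- INR_IZR_INZ; ring).
rewrite exp_plus. apply Req_le. ring.
Qed.

Lemma glide_C1 n : Defs.C1 (glide n).
Proof.
exists (fun _ v => (fst v, cos (IZR n * PI) * snd v)). intros p. split.
- apply glide_filterdiff.
- intros v. apply continuous_const.
Qed.

Lemma glide_diffeomorphism : C1_diffeomorphism (glide 1).
Proof.
exists (glide (-1)). split; [|split; apply glide_C1].
split; intros p; rewrite glide_comp; apply glide_0.
Qed.

(** * Length of paths and distance *)

Lemma mnorm_nonneg m p v : 0 <= mnorm m p v.
Proof. apply sqrt_pos. Qed.

Definition speed (m : riemannian_metric) (c : R -> plane) (t : R) : R :=
  mnorm m (c t) (Derive (fun u => fst (c u)) t, Derive (fun u => snd (c u)) t).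

Lemma continuous_mnorm m (c c' : R -> plane) t :
  continuous c t -> continuous c' t ->
  continuous (fun t => mnorm m (c t) (c' t)) t.
Proof.
intros Hc Hc'. unfold mnorm. continuity_of_formula.
- apply (continuous_comp c (g11 m)); [exact Hc|apply g11_continuous].
- apply (continuous_comp c (g12 m)); [exact Hc|apply g12_continuous].
- apply (continuous_comp c (g22 m)); [exact Hc|apply g22_continuous].
Qed.

(** The mean value inequality with a variable bound on the derivative. *)
Lemma RInt_bounds_increment (f u u' : R -> R) (K a b : R) :
  a <= b -> (forall t, continuous f t) -> (forall t, is_derive u t (u' t)) ->
  (forall t, a <= t <= b -> Rabs (u' t) <= K * f t) ->
  Rabs (u b - u a) <= K * RInt f a b.
Proof.
intros Hab Hf Hu Hb.
assert (Hex : forall s t, ex_RInt f s t).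
{ intros s t. apply (@ex_RInt_continuous R_CompleteNormedModule). intros z _. apply Hf. }
assert (HI : forall t, is_derive (RInt f a) t (f t)).
{ intros t. apply (is_derive_RInt f (RInt f a) a t); [|apply Hf].
  apply filter_forall. intros z. apply (@RInt_correct R_CompleteNormedModule), Hex. }
assert (Hinc : forall e, e = 1 \/ e = - 1 -> e * (u b - u a) <= K * RInt f a b).
{ intros e He.
  set (w := fun t => K * RInt f a t - e * u t).
  assert (Hw : forall t, is_derive w t (K * f t - e * u' t)).
  { intros t. unfold w. apply @is_derive_minus; now apply is_derive_scal. }
  destruct (MVT_gen w a b (fun t => K * f t - e * u' t)) as [t [Ht E]].
  - intros t _. apply Hw.
  - intros t _. apply continuity_pt_filterlim.
    apply (ex_derive_continuous w). exists (K * f t - e * u' t). apply Hw.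
  - rewrite Rmin_left, Rmax_right in Ht by lra. specialize (Hb t Ht).
    unfold w in E. rewrite RInt_point in E. unfold zero in E; simpl in E.
    assert (P : 0 <= K * f t - e * u' t).
    { apply Rabs_le_between in Hb. destruct He as [-> | ->]; lra. }
    assert (0 <= (K * f t - e * u' t) * (b - a)) by (apply Rmult_le_pos; lra).
    lra. }
pose proof (Hinc 1 (or_introl eq_refl)). pose proof (Hinc (- 1) (or_intror eq_refl)).
apply Rabs_le. lra.
Qed.

Lemma speed_of_piece m (c e e' : R -> plane) (a b t : R) :
  C1_curve m_infty p_infty e e' ->
  (forall t, a <= t <= b -> c t = e t) -> a < t < b ->
  speed m c t = mnorm m (e t) (e' t).
Proof.
intros He E Ht. unfold speed. rewrite E by lra.
assert (N : locally t (fun z => c z = e z)).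
{ assert (N : locally t (fun z => a < z /\ z < b)).
  { apply (open_and (fun z => a < z) (fun z => z < b));
      [apply open_gt|apply open_lt|exact Ht]. }
  revert N; apply filter_imp; intros z Hz. apply E. lra. }
destruct (He t (plane_interval_all t)) as [D _].
replace (Derive (fun u => fst (c u)) t) with (fst (e' t)).
replace (Derive (fun u => snd (c u)) t) with (snd (e' t)).
- now rewrite <- surjective_pairing.
- symmetry. apply is_derive_unique.
  apply (is_derive_ext_loc (fun u => snd (e u))); [|now apply is_derive_snd].
  revert N; apply filter_imp; intros z ->. reflexivity.
- symmetry. apply is_derive_unique.
  apply (is_derive_ext_loc (fun u => fst (e u))); [|now apply is_derive_fst].
  revert N; apply filter_imp; intros z ->. reflexivity.
Qed.

Definition differential_along (phi : plane -> R) (dphi : plane -> plane -> R) :=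
  forall e e', C1_curve m_infty p_infty e e' ->
  forall t, is_derive (fun t => phi (e t)) t (dphi (e t) (e' t)).

Lemma piece_increment m phi dphi K (c e e' : R -> plane) (a b : R) :
  differential_along phi dphi -> a <= b -> C1_curve m_infty p_infty e e' ->
  (forall t, a <= t <= b -> c t = e t) ->
  (forall t, a <= t <= b -> forall v, Rabs (dphi (c t) v) <= K * mnorm m (c t) v) ->
  ex_RInt (speed m c) a b /\
  Rabs (phi (c b) - phi (c a)) <= K * RInt (speed m c) a b.
Proof.
intros Hphi Hab He E Hb.
assert (Hs : forall t, Rmin a b < t < Rmax a b ->
  mnorm m (e t) (e' t) = speed m c t).
{ intros t. rewrite Rmin_left, Rmax_right by lra. intros Ht. symmetry.
  now apply (speed_of_piece m c e e' a b). }
assert (Hc : forall t, continuous (fun t => mnorm m (e t) (e' t)) t).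
{ intros t. destruct (He t (plane_interval_all t)) as [D C].
  apply continuous_mnorm; [|exact C].
  apply (ex_derive_continuous e). now exists (e' t). }
split.
- apply (ex_RInt_ext (fun t => mnorm m (e t) (e' t))); [exact Hs|].
  apply (@ex_RInt_continuous R_CompleteNormedModule). intros z _. apply Hc.
- rewrite <- (RInt_ext _ _ _ _ Hs), !E by lra.
  apply (RInt_bounds_increment _ (fun t => phi (e t))
           (fun t => dphi (e t) (e' t))); [exact Hab|exact Hc|now apply Hphi|].
  intros t Ht. rewrite <- E by exact Ht. now apply Hb.
Qed.

(** The method to bound lengths from below: along a path, a function whose
    differential is bounded by K times the norm varies by at most K times the
    length. The bound on the differential is only needed on the path, so that
    an estimate valid in a part of the plane applies to the paths confined to
    it. The integrability of the speed is proved by the same induction on the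
    pieces of the path. *)
Lemma path_increment m phi dphi K (c : R -> plane) :
  differential_along phi dphi -> piecewise_C1 c -> 0 <= K ->
  (forall t, 0 <= t <= 1 -> forall v, Rabs (dphi (c t) v) <= K * mnorm m (c t) v) ->
  ex_RInt (speed m c) 0 1 /\
  forall t, 0 <= t <= 1 -> Rabs (phi (c t) - phi (c 0)) <= K * path_length m c.
Proof.
intros Hphi [n [s [Hs0 [Hsn Hs]]]] HK Hb.
assert (Hmono : forall i, (i <= n)%nat -> 0 <= s i).
{ induction i as [|i IH]; intros Hi; [lra|].
  destruct (Hs i) as [H _]; [lia|]. assert (0 <= s i) by (apply IH; lia). lra. }
assert (Hmono' : forall i, (i <= n)%nat -> s (n - i)%nat <= 1).
{ induction i as [|i IH]; intros Hi; [rewrite Nat.sub_0_r; lra|].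
  destruct (Hs (n - S i)%nat) as [H _]; [lia|].
  replace (S (n - S i)) with (n - i)%nat in H by lia.
  assert (s (n - i)%nat <= 1) by (apply IH; lia). lra. }
assert (Main : forall i, (i <= n)%nat -> forall t, 0 <= t <= s i ->
  ex_RInt (speed m c) 0 t /\
  Rabs (phi (c t) - phi (c 0)) <= K * RInt (speed m c) 0 t).
{ induction i as [|i IH]; intros Hi t Ht.
  - assert (t = 0) by lra. subst t. split; [apply ex_RInt_point|].
    rewrite RInt_point, Rminus_diag, Rabs_R0. unfold zero; simpl. lra.
  - destruct (Rle_lt_dec t (s i)) as [L|L]; [apply IH; [lia|lra]|].
    destruct (Hs i) as [Hlt [e [e' [He E]]]]; [lia|].
    destruct (IH (Nat.lt_le_incl _ _ Hi) (s i)) as [IH1 IH2].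
    { pose proof (Hmono i (Nat.lt_le_incl _ _ Hi)). lra. }
    assert (HSi : s (S i) <= 1).
    { replace (S i) with (n - (n - S i))%nat by lia. apply Hmono'. lia. }
    pose proof (Hmono i (Nat.lt_le_incl _ _ Hi)) as Hsi.
    destruct (piece_increment m phi dphi K c e e' (s i) t Hphi) as [P1 P2];
      [lra|exact He| | |].
    + intros z Hz. apply E. lra.
    + intros z Hz. apply Hb. lra.
    + split; [now apply ex_RInt_Chasles with (s i)|].
      rewrite <- (RInt_Chasles (speed m c) 0 (s i) t IH1 P1).
      unfold plus; simpl. rewrite Rmult_plus_distr_l.
      replace (phi (c t) - phi (c 0))
        with ((phi (c (s i)) - phi (c 0)) + (phi (c t) - phi (c (s i)))) by ring.
      eapply Rle_trans; [apply Rabs_triang|]. lra. }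
assert (Hex : ex_RInt (speed m c) 0 1) by (apply (Main n); [lia|lra]).
split; [exact Hex|]. intros t Ht.
destruct (Main n (Nat.le_refl n) t) as [Ex Hle]; [lra|].
eapply Rle_trans; [exact Hle|]. apply Rmult_le_compat_l; [exact HK|].
assert (Ex' : ex_RInt (speed m c) t 1).
{ now apply (@ex_RInt_Chasles_2 R_CompleteNormedModule) with 0. }
change (path_length m c) with (RInt (speed m c) 0 1).
rewrite <- (RInt_Chasles (speed m c) 0 t 1 Ex Ex'). unfold plus; simpl.
assert (0 <= RInt (speed m c) t 1).
{ apply RInt_ge_0; [lra|exact Ex'|]. intros z _. apply mnorm_nonneg. }
lra.
Qed.

Lemma path_length_nonneg m c : piecewise_C1 c -> 0 <= path_length m c.
Proof.
intros H.
destruct (path_increment m (fun _ => 0) (fun _ _ => 0) 0 c) as [Hex _].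
- intros e e' _ t. apply @is_derive_const.
- exact H.
- lra.
- intros t _ v. rewrite Rabs_R0. lra.
- apply RInt_ge_0; [lra|exact Hex|]. intros z _. apply mnorm_nonneg.
Qed.

Definition segment (p q : plane) (t : R) : plane :=
  (fst p + t * (fst q - fst p), snd p + t * (snd q - snd p)).

Lemma segment_C1 p q :
  C1_curve m_infty p_infty (segment p q) (fun _ => (fst q - fst p, snd q - snd p)).
Proof.
intros t _. split; [|apply continuous_const].
apply (is_derive_pair (fun t => fst p + t * (fst q - fst p))
                      (fun t => snd p + t * (snd q - snd p)));
  apply is_derive_affine.
Qed.

Lemma segment_piecewise_C1 p q : piecewise_C1 (segment p q).
Proof.
exists 1%nat, INR. split; [reflexivity|]. split; [reflexivity|].
intros i Hi. split; [apply lt_INR; lia|].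
exists (segment p q), (fun _ => (fst q - fst p, snd q - snd p)).
split; [apply segment_C1|]. reflexivity.
Qed.

Lemma segment_ends p q : segment p q 0 = p /\ segment p q 1 = q.
Proof.
split; unfold segment.
- rewrite (surjective_pairing p) at 5. f_equal; ring.
- rewrite (surjective_pairing q) at 3. f_equal; ring.
Qed.

Definition path_lengths m p q (l : R) : Prop :=
  exists c : R -> plane,
    piecewise_C1 c /\ c 0 = p /\ c 1 = q /\ l = path_length m c.

(** The infimum that defines the distance is finite. *)
Lemma mdist_glb m p q : is_glb_Rbar (path_lengths m p q) (mdist m p q).
Proof.
pose proof (Glb_Rbar_correct (path_lengths m p q)) as H.
unfold mdist. fold (path_lengths m p q).
destruct (segment_ends p q) as [E0 E1].
assert (L : path_lengths m p q (path_length m (segment p q))).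
{ exists (segment p q). repeat split; auto using segment_piecewise_C1. }
destruct (Glb_Rbar (path_lengths m p q)) as [g| |].
- exact H.
- destruct H as [H _]. now specialize (H _ L).
- destruct H as [_ H]. destruct (H (Finite 0)).
  intros l [c [Hc [_ [_ ->]]]]. simpl. now apply path_length_nonneg.
Qed.

Lemma mdist_nonneg m p q : 0 <= mdist m p q.
Proof.
destruct (mdist_glb m p q) as [_ H]. apply (H (Finite 0)).
intros l [c [Hc [_ [_ ->]]]]. simpl. now apply path_length_nonneg.
Qed.

Lemma short_path m p q eps :
  mdist m p q < eps ->
  exists c, piecewise_C1 c /\ c 0 = p /\ c 1 = q /\ path_length m c < eps.
Proof.
intros H. apply Classical_Prop.NNPP. intros N.
destruct (mdist_glb m p q) as [_ G].
assert (K : Rbar_le eps (mdist m p q)).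
{ apply G. intros l [c [Hc [E0 [E1 ->]]]]. simpl. apply Rnot_lt_le. intros L.
  apply N. now exists c. }
simpl in K. lra.
Qed.

Lemma mdist_segment_bound m p q M :
  (forall t, 0 <= t <= 1 ->
     mnorm m (segment p q t) (fst q - fst p, snd q - snd p) <= M) ->
  mdist m p q <= M.
Proof.
intros HM. destruct (mdist_glb m p q) as [G _].
destruct (segment_ends p q) as [E0 E1].
assert (L : path_lengths m p q (path_length m (segment p q))).
{ exists (segment p q). repeat split; auto using segment_piecewise_C1. }
specialize (G _ L). simpl in G. eapply Rle_trans; [exact G|].
assert (Hex : ex_RInt (speed m (segment p q)) 0 1).
{ destruct (path_increment m (fun _ => 0) (fun _ _ => 0) 0 (segment p q)) as [Hex _];
    [|apply segment_piecewise_C1|lra| |exact Hex].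
  - intros e e' _ t. apply @is_derive_const.
  - intros t _ v. rewrite Rabs_R0. lra. }
change (path_length m (segment p q)) with (RInt (speed m (segment p q)) 0 1).
replace M with (RInt (fun _ => M) 0 1)
  by (rewrite RInt_const; unfold scal; simpl; unfold mult; simpl; ring).
apply RInt_le; [lra|exact Hex|apply ex_RInt_const|].
intros t Ht.
rewrite (speed_of_piece m _ (segment p q) (fun _ => (fst q - fst p, snd q - snd p)) 0 1);
  [apply HM; lra|apply segment_C1|reflexivity|exact Ht].
Qed.

(** * Completeness of the metric *)

(** A continuous choice of the argument of the vector (cos x, e^x sin x): the
    arc tangent is the angle from (cos x, sin x) to this vector, which is less
    than PI / 2. For large x this vector stays near the vertical axis except
    when x is close to n PI, and for large - x it stays near the horizontal axis
    except when x is close to PI / 2 + n PI. *)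
Definition staircase (x : R) : R :=
  x + atan ((exp x - 1) * sin x * cos x / (cos x ^ 2 + exp x * sin x ^ 2)).

Lemma exp_mix_pos (A B x : R) : 0 < A -> 0 < B -> 0 < A * cos x ^ 2 + B * sin x ^ 2.
Proof.
intros HA HB. pose proof (sin2_cos2 x) as K. unfold Rsqr in K.
pose proof (pow2_ge_0 (cos x)). pose proof (pow2_ge_0 (sin x)).
destruct (Req_dec (sin x) 0) as [E|E].
- rewrite E in *. nra.
- assert (0 < sin x ^ 2) by now apply pow2_gt_0. nra.
Qed.

Lemma staircase_close x : Rabs (staircase x - x) <= PI / 2.
Proof.
unfold staircase.
set (r := (exp x - 1) * sin x * cos x / (cos x ^ 2 + exp x * sin x ^ 2)).
pose proof (atan_bound r). apply Rabs_le. lra.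
Qed.

Lemma staircase_derive x :
  is_derive staircase x
    ((1 + sin x * cos x) / (exp (- x) * cos x ^ 2 + exp x * sin x ^ 2)).
Proof.
pose proof (exp_pos x) as Hx.
pose proof (exp_mix_pos 1 (exp x) x Rlt_0_1 Hx) as HQ.
pose proof (exp_mix_pos 1 (exp x ^ 2) x Rlt_0_1 (pow_lt _ 2 Hx)) as HR.
unfold staircase. auto_derive; [lra|].
rewrite exp_Ropp.
pose proof (sin2_cos2 x) as K. unfold Rsqr in K.
set (M := exp x) in *. set (s := sin x) in *. set (c := cos x) in *.
clearbody M s c.
assert (HN : (c ^ 2 + M * s ^ 2) ^ 2 + ((M - 1) * s * c) ^ 2 = c ^ 2 + M ^ 2 * s ^ 2).
{ transitivity ((c ^ 2 + M ^ 2 * s ^ 2) * (s * s + c * c)); [ring|].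
  rewrite K. ring. }
set (N := (M - 1) * s * c) in *.
set (Q := c ^ 2 + M * s ^ 2) in *.
set (N' := (M * s + (M - 1) * c) * c - (M - 1) * s * s).
set (Q' := M * s ^ 2 + 2 * (M - 1) * s * c).
assert (HQ0 : Q <> 0) by (unfold Q; lra).
assert (HN0 : Q ^ 2 + N ^ 2 <> 0) by (rewrite HN; lra).
transitivity (1 + (N' * Q - N * Q') / (Q ^ 2 + N ^ 2)).
- unfold N', Q'. replace (c * (c * 1) + M * (s * (s * 1))) with Q by (unfold Q; ring).
  replace ((M + - (1)) * s * c) with N by (unfold N; ring).
  field. split; [exact HN0|exact HQ0].
- rewrite HN.
  assert (E : c ^ 2 + M ^ 2 * s ^ 2 + (N' * Q - N * Q') = M * (1 + s * c)).
  { transitivity (c ^ 2 + M ^ 2 * s ^ 2 + M * s * c * (s * s + c * c)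
                    + (M - 1) * (s * s + c * c) * (c ^ 2 - M * s ^ 2)).
    - unfold N', Q, N, Q'. ring.
    - rewrite K. transitivity (M * (s * s + c * c) + M * s * c); [ring|].
      rewrite K. ring. }
  replace (1 + (N' * Q - N * Q') / (c ^ 2 + M ^ 2 * s ^ 2))
    with ((c ^ 2 + M ^ 2 * s ^ 2 + (N' * Q - N * Q')) / (c ^ 2 + M ^ 2 * s ^ 2))
    by (field; lra).
  rewrite E. field. repeat split; lra.
Qed.

Lemma norm_dominates p v :
  Rabs (exp (- fst p) * unstable_form (fst p) v) <= mnorm anosov_metric p v /\
  Rabs (exp (fst p) * stable_form (fst p) v) <= mnorm anosov_metric p v.
Proof.
rewrite anosov_norm. set (a := exp (- fst p) * _). set (b := exp (fst p) * _).
split; rewrite <- sqrt_Rsqr_abs; apply sqrt_le_1_alt; unfold Rsqr; nra.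
Qed.

(** The denominator of the derivative of the staircase balances the weights of
    the metric. Up to the factor [frame_det], the form dx is
    sin^2 x a + cos x |cos x| b, where a and b are bounded by e^x and e^(-x)
    times the norm, so dx is bounded by the norm times the denominator. The
    coefficients of a and b vanish to the second order on the lines that are
    leaves, and this is what is needed. *)
Lemma staircase_speed p v :
  Rabs ((1 + sin (fst p) * cos (fst p)) /
        (exp (- fst p) * cos (fst p) ^ 2 + exp (fst p) * sin (fst p) ^ 2) * fst v)
  <= 2 * mnorm anosov_metric p v.
Proof.
destruct (norm_dominates p v) as [Ha Hb].
pose proof (frame_det_bound (fst p)) as HD.
pose proof (frame_fst (fst p) v) as E.
pose proof (exp_mix_pos _ _ (fst p) (exp_pos (- fst p)) (exp_pos (fst p))) as HW.
rewrite !Rabs_mult in Ha, Hb.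
rewrite (Rabs_pos_eq (exp _)) in Ha by (left; apply exp_pos).
rewrite (Rabs_pos_eq (exp _)) in Hb by (left; apply exp_pos).
assert (EE : exp (fst p) * exp (- fst p) = 1)
  by (rewrite <- exp_plus, Rplus_opp_r; apply exp_0).
pose proof (exp_pos (fst p)) as He. pose proof (exp_pos (- fst p)) as He'.
pose proof (sin2_cos2 (fst p)) as K. unfold Rsqr in K.
set (s := sin (fst p)) in *. set (c := cos (fst p)) in *.
set (a := unstable_form (fst p) v) in *. set (b := stable_form (fst p) v) in *.
set (e := exp (fst p)) in *. set (e' := exp (- fst p)) in *.
set (D := frame_det (fst p)) in *. set (N := mnorm anosov_metric p v) in *.
set (W := e' * c ^ 2 + e * s ^ 2) in *.
assert (HN : 0 <= N) by apply mnorm_nonneg.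
assert (Hv : D * Rabs (fst v) <= W * N).
{ rewrite <- (Rabs_pos_eq D) by lra. rewrite <- Rabs_mult, E.
  eapply Rle_trans; [apply Rabs_triang|].
  rewrite !Rabs_mult, Rabs_Rabsolu, (Rabs_pos_eq (s ^ 2)) by apply pow2_ge_0.
  replace (Rabs c * Rabs c) with (c ^ 2) by (rewrite <- Rabs_mult, Rabs_pos_eq; nra).
  replace (s ^ 2 * Rabs a) with (e * s ^ 2 * (e' * Rabs a))
    by (transitivity (e * e' * (s ^ 2 * Rabs a)); [ring|rewrite EE; ring]).
  replace (c ^ 2 * Rabs b) with (e' * c ^ 2 * (e * Rabs b))
    by (transitivity (e * e' * (c ^ 2 * Rabs b)); [ring|rewrite EE; ring]).
  assert (e * s ^ 2 * (e' * Rabs a) <= e * s ^ 2 * N).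
  { apply Rmult_le_compat_l; [|exact Ha]. apply Rmult_le_pos; [lra|apply pow2_ge_0]. }
  assert (e' * c ^ 2 * (e * Rabs b) <= e' * c ^ 2 * N).
  { apply Rmult_le_compat_l; [|exact Hb]. apply Rmult_le_pos; [lra|apply pow2_ge_0]. }
  unfold W. lra. }
assert (Hsc : 0 <= 1 + s * c <= 3 / 2).
{ pose proof (pow2_ge_0 (s + c)). pose proof (pow2_ge_0 (s - c)). split; lra. }
rewrite Rabs_mult, Rabs_pos_eq; [|apply Rmult_le_pos; [lra|left; now apply Rinv_0_lt_compat]].
apply (Rmult_le_reg_l W); [exact HW|].
replace (W * ((1 + s * c) / W * Rabs (fst v))) with ((1 + s * c) * Rabs (fst v))
  by (field; lra).
pose proof (Rabs_pos (fst v)).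
assert ((1 + s * c) * Rabs (fst v) <= 3 / 2 * Rabs (fst v))
  by (apply Rmult_le_compat_r; lra).
assert (3 / 4 * Rabs (fst v) <= D * Rabs (fst v)) by (apply Rmult_le_compat_r; lra).
lra.
Qed.

Lemma coordinates_speed X p v :
  Rabs (fst p) <= X ->
  Rabs (fst v) <= 4 * exp X * mnorm anosov_metric p v /\
  Rabs (snd v) <= 4 * exp X * mnorm anosov_metric p v.
Proof.
intros HX.
destruct (norm_dominates p v) as [Ha Hb].
pose proof (frame_det_bound (fst p)) as HD.
pose proof (frame_fst (fst p) v) as E1. pose proof (frame_snd (fst p) v) as E2.
rewrite !Rabs_mult in Ha, Hb.
rewrite (Rabs_pos_eq (exp _)) in Ha by (left; apply exp_pos).
rewrite (Rabs_pos_eq (exp _)) in Hb by (left; apply exp_pos).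
pose proof (exp_pos X) as HeX.
set (N := mnorm anosov_metric p v) in *.
assert (HN : 0 <= N) by apply mnorm_nonneg.
apply Rabs_le_between in HX.
assert (Scale : forall z r, - X <= z -> exp z * Rabs r <= N -> Rabs r <= exp X * N).
{ intros z r Hz H. apply (Rmult_le_reg_l (exp (- X))); [apply exp_pos|].
  rewrite <- Rmult_assoc, <- exp_plus, Rplus_opp_l, exp_0, Rmult_1_l.
  eapply Rle_trans; [|exact H]. apply Rmult_le_compat_r; [apply Rabs_pos|].
  destruct Hz as [Hz| ->]; [left; now apply exp_increasing|right; reflexivity]. }
apply Scale in Ha; [|lra]. apply Scale in Hb; [|lra].
set (a := unstable_form (fst p) v) in *. set (b := stable_form (fst p) v) in *.
set (D := frame_det (fst p)) in *.
assert (Hc : Rabs (cos (fst p)) <= 1)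
  by (apply Rabs_le; destruct (COS_bound (fst p)); split; lra).
assert (Hs : Rabs (sin (fst p)) <= 1)
  by (apply Rabs_le; destruct (SIN_bound (fst p)); split; lra).
assert (Contract : forall k r, Rabs k <= 1 -> Rabs r <= exp X * N ->
  Rabs (k * r) <= exp X * N).
{ intros k r Hk Hr. rewrite Rabs_mult. pose proof (Rabs_pos r). nra. }
assert (Finish : forall r z, D * r = z -> Rabs z <= 2 * (exp X * N) ->
  Rabs r <= 4 * exp X * N).
{ intros r z E H. rewrite <- E, Rabs_mult, (Rabs_pos_eq D) in H by lra.
  pose proof (Rabs_pos r).
  assert (3 / 4 * Rabs r <= D * Rabs r) by (apply Rmult_le_compat_r; lra).
  assert (0 <= exp X * N) by (apply Rmult_le_pos; lra). lra. }
split.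
- apply (Finish _ _ E1). eapply Rle_trans; [apply Rabs_triang|].
  replace (sin (fst p) ^ 2 * a) with (sin (fst p) * (sin (fst p) * a)) by ring.
  rewrite Rmult_assoc.
  pose proof (Contract _ _ Hs (Contract _ _ Hs Ha)).
  assert (Hc' : Rabs (Rabs (cos (fst p))) <= 1) by now rewrite Rabs_Rabsolu.
  pose proof (Contract _ _ Hc (Contract _ _ Hc' Hb)). lra.
- apply (Finish _ _ E2). unfold Rminus.
  eapply Rle_trans; [apply Rabs_triang|]. rewrite Rabs_Ropp.
  pose proof (Contract _ _ Hc Ha). lra.
Qed.

Lemma norm_upper_bound X p v :
  Rabs (fst p) <= X ->
  mnorm anosov_metric p v <= 2 * exp X * (Rabs (fst v) + Rabs (snd v)).
Proof.
intros HX. rewrite anosov_norm.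
pose proof (exp_pos X) as HeX. apply Rabs_le_between in HX.
assert (Hc : Rabs (cos (fst p)) <= 1)
  by (apply Rabs_le; destruct (COS_bound (fst p)); split; lra).
assert (Hs : Rabs (sin (fst p)) <= 1)
  by (apply Rabs_le; destruct (SIN_bound (fst p)); split; lra).
assert (Contract : forall k r, Rabs k <= 1 -> Rabs (k * r) <= Rabs r).
{ intros k r Hk. rewrite Rabs_mult. pose proof (Rabs_pos r). nra. }
assert (Ha : Rabs (unstable_form (fst p) v) <= Rabs (fst v) + Rabs (snd v)).
{ unfold unstable_form, Rminus. eapply Rle_trans; [apply Rabs_triang|].
  rewrite Rabs_Ropp, Rmult_assoc.
  assert (Hc' : Rabs (Rabs (cos (fst p))) <= 1) by now rewrite Rabs_Rabsolu.
  pose proof (Contract _ (Rabs (cos (fst p)) * snd v) Hc).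
  pose proof (Contract _ (snd v) Hc'). lra. }
assert (Hb : Rabs (stable_form (fst p) v) <= Rabs (fst v) + Rabs (snd v)).
{ unfold stable_form. eapply Rle_trans; [apply Rabs_triang|].
  replace (sin (fst p) ^ 2 * snd v) with (sin (fst p) * (sin (fst p) * snd v)) by ring.
  pose proof (Contract _ (fst v) Hc). pose proof (Contract _ (snd v) Hs).
  pose proof (Contract _ (sin (fst p) * snd v) Hs). lra. }
assert (Scale : forall z r, z <= X -> Rabs r <= Rabs (fst v) + Rabs (snd v) ->
  Rabs (exp z * r) <= exp X * (Rabs (fst v) + Rabs (snd v))).
{ intros z r Hz H. rewrite Rabs_mult, (Rabs_pos_eq (exp z)) by (left; apply exp_pos).
  apply Rmult_le_compat; [left; apply exp_pos|apply Rabs_pos| |exact H].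
  destruct Hz as [Hz| ->]; [left; now apply exp_increasing|right; reflexivity]. }
apply (Scale (- fst p)) in Ha; [|lra]. apply (Scale (fst p)) in Hb; [|lra].
set (a := exp (- fst p) * _) in *. set (b := exp (fst p) * _) in *.
pose proof (Rabs_pos a). pose proof (Rabs_pos b).
apply Rle_trans with (Rabs a + Rabs b); [|lra].
rewrite <- (sqrt_pow2 (Rabs a + Rabs b)) by lra. apply sqrt_le_1_alt.
rewrite <- (pow2_abs a), <- (pow2_abs b). nra.
Qed.

Lemma staircase_differential_along :
  differential_along (fun p => staircase (fst p))
    (fun p v => (1 + sin (fst p) * cos (fst p)) /
        (exp (- fst p) * cos (fst p) ^ 2 + exp (fst p) * sin (fst p) ^ 2) * fst v).
Proof.
intros e e' He t. destruct (He t (plane_interval_all t)) as [D _].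
apply is_derive_fst in D.
rewrite Rmult_comm.
exact (is_derive_comp staircase (fun t => fst (e t)) t _ _ (staircase_derive _) D).
Qed.

Lemma fst_differential_along : differential_along fst (fun _ v => fst v).
Proof.
intros e e' He t. destruct (He t (plane_interval_all t)) as [D _].
now apply is_derive_fst.
Qed.

Lemma snd_differential_along : differential_along snd (fun _ v => snd v).
Proof.
intros e e' He t. destruct (He t (plane_interval_all t)) as [D _].
now apply is_derive_snd.
Qed.

(** The staircase varies by at most 2 along the path, and the abscissa by at most
    PI more. *)
Lemma path_confined (c : R -> plane) :
  piecewise_C1 c -> path_length anosov_metric c <= 1 ->
  forall t, 0 <= t <= 1 -> Rabs (fst (c t)) <= Rabs (fst (c 0)) + 2 + PI.
Proof.
intros Hc HL t Ht.
destruct (path_increment anosov_metric _ _ 2 c staircase_differential_along Hc)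
  as [_ H]; [lra|intros z _ v; apply staircase_speed|].
specialize (H t Ht). cbv beta in H.
pose proof (staircase_close (fst (c t))) as H1.
pose proof (staircase_close (fst (c 0))) as H2.
apply Rabs_le_between in H, H1, H2.
unfold Rabs. destruct (Rcase_abs (fst (c t))); destruct (Rcase_abs (fst (c 0))); lra.
Qed.

(** The short path that joins the two points is confined to the strip where the
    metric is bounded below by a multiple of the Euclidean one. *)
Lemma short_distance_coordinates p q X eps :
  Rabs (fst p) + 2 + PI <= X -> eps <= 1 -> mdist anosov_metric p q < eps ->
  Rabs (fst q) <= X /\ Rabs (fst q - fst p) <= 4 * exp X * eps /\
  Rabs (snd q - snd p) <= 4 * exp X * eps.
Proof.
intros HX Heps H. destruct (short_path _ _ _ _ H) as [c [Hc [<- [<- HL]]]].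
assert (HL1 : path_length anosov_metric c <= 1) by lra.
assert (Hin : forall t, 0 <= t <= 1 -> Rabs (fst (c t)) <= X).
{ intros t Ht. pose proof (path_confined c Hc HL1 t Ht). lra. }
pose proof (exp_pos X) as HeX.
assert (HK : 0 <= 4 * exp X) by lra.
assert (Hle : 4 * exp X * path_length anosov_metric c <= 4 * exp X * eps)
  by (apply Rmult_le_compat_l; lra).
split; [apply Hin; lra|]. split.
- destruct (path_increment anosov_metric _ _ (4 * exp X) c fst_differential_along Hc HK)
    as [_ K]; [intros t Ht v; now apply coordinates_speed, Hin|].
  eapply Rle_trans; [apply (K 1); lra|exact Hle].
- destruct (path_increment anosov_metric _ _ (4 * exp X) c snd_differential_along Hc HK)
    as [_ K]; [intros t Ht v; now apply coordinates_speed, Hin|].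
  eapply Rle_trans; [apply (K 1); lra|exact Hle].
Qed.

Lemma mdist_upper_bound p q X :
  Rabs (fst p) <= X -> Rabs (fst q) <= X ->
  mdist anosov_metric p q <= 2 * exp X * (Rabs (fst q - fst p) + Rabs (snd q - snd p)).
Proof.
intros Hp Hq. apply mdist_segment_bound. intros t Ht.
apply norm_upper_bound. unfold segment; simpl.
apply Rabs_le_between in Hp, Hq. apply Rabs_le. nra.
Qed.

Lemma cauchy_by_distance (u : nat -> R) (x : nat -> plane) K :
  0 < K ->
  (forall eps, 0 < eps -> exists N, forall i j, (N <= i)%nat -> (N <= j)%nat ->
     mdist anosov_metric (x i) (x j) < eps) ->
  (exists N, forall i j eps, (N <= i)%nat -> (N <= j)%nat -> 0 < eps <= 1 ->
     mdist anosov_metric (x i) (x j) < eps -> Rabs (u j - u i) <= K * eps) ->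
  exists l : R, is_lim_seq u l.
Proof.
intros HK Hx [N0 Hu].
destruct (proj2 (ex_lim_seq_cauchy_corr u)) as [l Hl]; [|now exists l].
intros [eps Heps]; simpl.
set (d := Rmin 1 (eps / (2 * K))).
assert (Hd : 0 < d).
{ apply Rmin_pos; [lra|]. apply Rdiv_lt_0_compat; lra. }
destruct (Hx d Hd) as [N HN]. exists (Nat.max N N0). intros i j Hi Hj.
assert (L : Rabs (u i - u j) <= K * d).
{ apply Hu; [lia|lia| |apply HN; lia]. split; [exact Hd|apply Rmin_l]. }
assert (K * d <= K * (eps / (2 * K)))
  by (apply Rmult_le_compat_l; [lra|apply Rmin_r]).
replace (K * (eps / (2 * K))) with (eps / 2) in H by (field; lra). lra.
Qed.

(** The tail of a Cauchy sequence is confined to a vertical strip. The two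
    metrics are comparable there, so the sequence converges in the Euclidean
    plane, and then also for the distance. *)
Lemma anosov_metric_complete : complete_metric anosov_metric.
Proof.
intros x Hx.
destruct (Hx 1 Rlt_0_1) as [N0 HN0].
set (X1 := Rabs (fst (x N0)) + 2 + PI).
assert (HX1 : forall i, (N0 <= i)%nat -> Rabs (fst (x i)) <= X1).
{ intros i Hi. apply (short_distance_coordinates (x N0) (x i) X1 1);
    [apply Rle_refl|lra|apply HN0; lia]. }
set (X := X1 + 2 + PI).
assert (HK : 0 < 4 * exp X) by (pose proof (exp_pos X); lra).
assert (HX : forall i, (N0 <= i)%nat -> Rabs (fst (x i)) + 2 + PI <= X).
{ intros i Hi. specialize (HX1 i Hi). unfold X. lra. }
destruct (cauchy_by_distance (fun n => fst (x n)) x _ HK Hx) as [l1 Hl1].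
{ exists N0. intros i j eps Hi Hj Heps H.
  now apply (short_distance_coordinates (x i) (x j) X eps (HX i Hi)). }
destruct (cauchy_by_distance (fun n => snd (x n)) x _ HK Hx) as [l2 Hl2].
{ exists N0. intros i j eps Hi Hj Heps H.
  now apply (short_distance_coordinates (x i) (x j) X eps (HX i Hi)). }
exists (l1, l2).
set (Y := Rmax X1 (Rabs l1)).
apply (is_lim_seq_le_le_loc (fun _ => 0) _
  (fun n => 2 * exp Y * (Rabs (l1 - fst (x n)) + Rabs (l2 - snd (x n))))).
- exists N0. intros n Hn. split; [apply mdist_nonneg|].
  apply (mdist_upper_bound (x n) (l1, l2) Y).
  + eapply Rle_trans; [now apply HX1|apply Rmax_l].
  + apply Rmax_r.
- apply is_lim_seq_const.
- assert (Z : forall (u : nat -> R) (l : R), is_lim_seq u l ->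
    is_lim_seq (fun n => Rabs (l - u n)) 0).
  { intros u l H. replace 0 with (Rabs (l - l)) by (rewrite Rminus_diag; apply Rabs_R0).
    apply (is_lim_seq_abs _ (l - l)). apply is_lim_seq_minus'; [apply is_lim_seq_const|exact H]. }
  replace (Finite 0) with (Rbar_mult (2 * exp Y) (0 + 0))
    by (simpl; f_equal; ring).
  apply is_lim_seq_scal_l. apply is_lim_seq_plus'; now apply Z.
Qed.

(** * Absence of a conjugacy to a translation *)

Lemma continuous_periodic_bounded (f : R -> R) (T : R) :
  0 < T -> (forall t, continuous f t) -> (forall t, f (t + T) = f t) ->
  exists B, forall t, f t <= B.
Proof.
intros HT Hf Hp.
destruct (continuity_ab_maj f 0 T) as [M [HM _]]; [lra| |].
{ intros t _. apply continuity_pt_filterlim, Hf. }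
assert (Hn : forall n t, f (t + INR n * T) = f t).
{ induction n as [|n IH]; intros t; [f_equal; simpl; ring|].
  rewrite S_INR. replace (t + (INR n + 1) * T) with ((t + INR n * T) + T) by ring.
  now rewrite Hp. }
assert (Hz : forall n t, f (t + IZR n * T) = f t).
{ intros n t. destruct (Z_le_gt_dec 0 n) as [L|L].
  - rewrite <- (Z2Nat.id n L), <- INR_IZR_INZ. apply Hn.
  - rewrite <- (Hn (Z.to_nat (- n)) (t + IZR n * T)). f_equal.
    rewrite INR_IZR_INZ, Z2Nat.id, opp_IZR by lia. ring. }
exists (f M). intros t.
destruct (archimed (t / T)) as [H1 H2].
set (n := (1 - up (t / T))%Z).
rewrite <- (Hz n t). apply HM. unfold n. rewrite minus_IZR.
set (r := t / T) in *. replace t with (r * T) by (unfold r; field; lra). nra.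
Qed.

(** With ell a linear form that vanishes on w, the function ell o h is periodic,
    hence bounded by some B, on the axis y = 0. On the line ell = B + 1, which is
    invariant by w, the second coordinate of the inverse k of h is not zero;
    but translation by w changes its sign. *)
Lemma glide_not_conjugate : ~ conjugate_to_translation (glide 1).
Proof.
intros [h [k [w [[[Hkh Hhk] [Hh Hk]] E]]]].
assert (Ew : forall p, h (glide 1 p) = translation w (h p)).
{ intros p. rewrite <- (Hkh p) at 1. apply E. }
assert (Ek : forall q, k (translation w q) = glide 1 (k q)).
{ intros q. rewrite <- E. apply Hkh. }
assert (Htr : forall q, translation w q = (fst q + 1 * fst w, snd q + 1 * snd w)).
{ intros [q1 q2]. unfold translation, plus; simpl. unfold prod_plus; simpl.
  unfold plus; simpl. f_equal; ring. }
assert (Hw : 0 < fst w ^ 2 + snd w ^ 2).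
{ destruct (Req_dec (fst w) 0) as [E1|E1].
  - destruct (Req_dec (snd w) 0) as [E2|E2].
    + exfalso. apply (glide_fixed_point_free (0, 0)).
      rewrite <- (Hkh (glide 1 (0, 0))), Ew, Htr, E1, E2, !Rmult_0_r, !Rplus_0_r.
      rewrite <- surjective_pairing. apply Hkh.
    + pose proof (pow2_gt_0 _ E2). pose proof (pow2_ge_0 (fst w)). lra.
  - pose proof (pow2_gt_0 _ E1). pose proof (pow2_ge_0 (snd w)). lra. }
set (ell := fun q : plane => fst w * snd q - snd w * fst q).
assert (Hell : forall q t, ell (fst q + t * fst w, snd q + t * snd w) = ell q).
{ intros q t. unfold ell; simpl. ring. }
destruct (continuous_periodic_bounded (fun x => ell (h (x, 0))) PI PI_RGT_0)
  as [B HB].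
{ intros t. unfold ell.
  assert (C : continuous (fun x => h (x, 0)) t).
  { apply (continuous_comp (fun x => (x, 0)) h); [continuity_of_formula|apply Hh]. }
  continuity_of_formula. }
{ intros t. replace (t + PI, 0) with (glide 1 (t, 0)).
  - rewrite Ew, Htr. apply Hell.
  - unfold glide; simpl. f_equal; ring. }
set (r := (B + 1) / (fst w ^ 2 + snd w ^ 2)).
set (q0 := (- (r * snd w), r * fst w) : plane).
assert (Hq0 : ell q0 = B + 1) by (unfold ell, q0, r; simpl; field; lra).
set (line := fun t => (fst q0 + t * fst w, snd q0 + t * snd w) : plane).
set (f := fun t => snd (k (line t))).
assert (Hf : continuity f).
{ intros t. apply continuity_pt_filterlim.
  apply (continuous_snd_fct (fun t => k (line t))).
  apply (continuous_comp line k); [|apply Hk].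
  unfold line. continuity_of_formula. }
assert (Hflip : f 1 = - f 0).
{ unfold f. replace (line 1) with (translation w (line 0)).
  - rewrite Ek. unfold glide; simpl. rewrite Rmult_1_l, cos_PI. ring.
  - rewrite Htr. unfold line; simpl. f_equal; ring. }
destruct (IVT_gen f 0 1 0 Hf) as [t [_ Ht]].
{ rewrite Hflip. unfold Rmin, Rmax. destruct (Rle_dec (f 0) (- f 0)); lra. }
specialize (HB (fst (k (line t)))). 
assert (Hline : h (fst (k (line t)), 0) = line t).
{ rewrite <- Ht. unfold f. rewrite <- surjective_pairing. apply Hhk. }
cbv beta in HB. rewrite Hline in HB. unfold line in HB. rewrite Hell, Hq0 in HB. lra.
Qed.

Theorem mainTheorem1 :
  exists F : R * R -> R * R,
    Anosov F /\
    (forall p : R * R, F p <> p) /\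
    ~ conjugate_to_translation F.
Proof.
exists (glide 1). split; [|split].
- split; [exact glide_diffeomorphism|].
  exists anosov_metric, unstable_foliation, stable_foliation.
  split; [exact foliations_transversal|].
  split; [exact anosov_metric_complete|].
  split; [apply glide_preserves|].
  split; [apply glide_preserves|].
  exists 1, PI. split; [lra|]. split; [exact PI_RGT_0|].
  split; [exact glide_expands|exact glide_contracts].
- exact glide_fixed_point_free.
- exact glide_not_conjugate.
Qed.
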